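(* Let $c\in \mathcal{C}_{\mathrm{lin}}(\mathbb{R}^2)$ and let $\mu_1,\mu_2, \mu_3 \in \mathcal{P}(\mathbb{R})$ have finite first moments and satisfy $\mu_1 \preceq \mu_2 \preceq \mu_3$ in convex order. Let $T_d,T_u:\mathbb{R}\to\mathbb{R}$ be Borel functions with $T_d(x)\le x\le T_u(x)$ for all $x\in\mathbb{R}$, let $$q(x):=\frac{x-T_d(x)}{T_u(x)-T_d(x)}\mathbf{1}_{\{T_u(x)>T_d(x)\}}\in[0,1],\qquad x\in\mathbb{R}$$ (with $q(x)=0$ if $T_u(x)=T_d(x)$), and let $$\mathbb{Q}^*(\mathrm{d} x_1,\mathrm{d} x_3):=\mu_1(\mathrm{d} x_1)\big(q(x_1)\,\delta_{T_u(x_1)}(\mathrm{d}x_3)+(1-q(x_1))\,\delta_{T_d(x_1)}(\mathrm{d}x_3)\big).$$ Assume $\mathcal{Q}_c^*(\mu_1,\mu_3)=\{\mathbb{Q}^*\}$. Then $$\inf_{\mathbb{Q} \in \mathcal{M}(\mu_1,\mu_2,\mu_3)}\mathbb{E}_{\mathbb{Q}}[c(S_{t_1},S_{t_3})]=\inf_{\mathbb{Q} \in \mathcal{M}(\mu_1,\mu_3)}\mathbb{E}_{\mathbb{Q}}[c(S_{t_1},S_{t_3})]$$ if and only if there exists some $\widetilde{\mathbb{Q}} \in \mathcal{M}(\mu_1,\mu_2)$ with $$\widetilde{\mathbb{Q}} \big(T_d(S_{t_1}) \leq S_{t_2} \leq T_u(S_{t_1})\big)=1.$$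
   Context: $\mathcal{P}(\mathbb{R}^d)$ is the set of Borel probability measures on $\mathbb{R}^d$; $\delta_x$ is the Dirac measure at $x$. $\mathcal{C}_{\mathrm{lin}}(\mathbb{R}^d)$ is the set of continuous $c:\mathbb{R}^d\to\mathbb{R}$ with $\sup_{x\in\mathbb{R}^d}\frac{|c(x_1,\dots,x_d)|}{1+\sum_{i=1}^d|x_i|}<\infty$. Convex order: $\mu\preceq\nu$ if $\int f\,\mathrm{d}\mu\le\int f\,\mathrm{d}\nu$ for all convex $f:\mathbb{R}\to\mathbb{R}$ for which the integrals are finite. $(S_{t_1},S_{t_2},S_{t_3})$ denotes the canonical (coordinate) process on $\mathbb{R}^3$. $\mathcal{M}(\mu_1,\mu_2,\mu_3)\subset\mathcal{P}(\mathbb{R}^3)$ is the set of laws with one-dimensional marginals $\mu_1,\mu_2,\mu_3$ under which $(S_{t_1},S_{t_2},S_{t_3})$ is a martingale in its own filtration. For $j\in\{2,3\}$, $\mathcal{M}(\mu_1,\mu_j)\subset\mathcal{P}(\mathbb{R}^2)$ is the set of laws with marginals $\mu_1,\mu_j$ under which the coordinates, denoted $(S_{t_1},S_{t_j})$, form a martingale. $\mathcal{Q}_c^*(\mu_1,\mu_3):=\{\mathbb{Q}'\in\mathcal{M}(\mu_1,\mu_3): \mathbb{E}_{\mathbb{Q}'}[c(S_{t_1},S_{t_3})]=\inf_{\mathbb{Q}\in\mathcal{M}(\mu_1,\mu_3)}\mathbb{E}_{\mathbb{Q}}[c(S_{t_1},S_{t_3})]\}$. *)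

(* Defs.v *)
From HB Require Import structures.
From mathcomp Require Import all_boot all_order all_algebra.
From mathcomp Require Import all_classical all_reals all_analysis.
From mathcomp Require Import measurable_realfun giry.

Set Implicit Arguments.
Unset Strict Implicit.
Unset Printing Implicit Defensive.
Import Order.TTheory GRing.Theory Num.Theory.
Import numFieldNormedType.Exports.

Local Open Scope classical_set_scope.
Local Open Scope ring_scope.

Section processes.
Context (d : measure_display) (T : measurableType d) (R : realType).
Local Open Scope ereal_scope.

Definition has_law (P : probability T R) (X : T -> R) (mu : probability R R) :=
  forall A : set R, measurable A -> pushforward P X A = mu A.

(* Y is a version of E_P[X | G], for X integrable and G a sub-sigma-algebra;
   versions are determined only P-almost surely. *)
Definition is_cond_expectation (P : probability T R) (G : set (set T))
    (X Y : T -> R) :=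
  [/\ forall B : set R, measurable B -> G (Y @^-1` B),
      P.-integrable [set: T] (EFin \o Y) &
      forall A, G A -> \int[P]_(w in A) (Y w)%:E = \int[P]_(w in A) (X w)%:E].

(* sigma(X_0, ..., X_k) *)
Definition natural_filtration (n : nat) (X : 'I_n -> T -> R) (k : 'I_n) :
    set (set T) :=
  g_sigma_preimage (fun i : 'I_k.+1 => X (widen_ord (ltn_ord k) i)).

Definition martingale (P : probability T R) (n : nat) (X : 'I_n -> T -> R) :=
  (forall k, P.-integrable [set: T] (EFin \o X k)) /\
  (forall j k : 'I_n, (j <= k)%N ->
    is_cond_expectation P (natural_filtration X j) (X k) (X j)).

End processes.

Section martingale_transport.
Context (R : realType).
Local Open Scope ereal_scope.

Definition finite_first_moment (mu : probability R R) :=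
  mu.-integrable [set: R] (fun x : R => x%:E).

Definition convex_order (mu nu : probability R R) :=
  forall f : R -> R,
    convex_function (E := R^o) [set: R] f ->
    mu.-integrable [set: R] (EFin \o f) ->
    nu.-integrable [set: R] (EFin \o f) ->
    \int[mu]_x (f x)%:E <= \int[nu]_x (f x)%:E.

Definition C_lin2 (c : R * R -> R) :=
  continuous c /\
  has_ubound (range (fun x => `|c x| / (1 + (`|x.1| + `|x.2|))))%R.

Definition coords2 : 'I_2 -> R * R -> R := tnth [tuple fst; snd].

Definition coords3 : 'I_3 -> R * R * R -> R :=
  tnth [tuple fun w => w.1.1; fun w => w.1.2; snd].

Definition M2 (mu1 muj : probability R R) : set (probability (R * R)%type R) :=
  [set Q | [/\ has_law Q fst mu1, has_law Q snd muj & martingale Q coords2]].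

Definition M3 (mu1 mu2 mu3 : probability R R) :
    set (probability (R * R * R)%type R) :=
  [set Q | [/\ has_law Q (fun w => w.1.1) mu1, has_law Q (fun w => w.1.2) mu2,
               has_law Q snd mu3 & martingale Q coords3]].

Definition inf_M2 (c : R * R -> R) (mu1 mu3 : probability R R) : \bar R :=
  ereal_inf [set 'E_Q[c] | Q in M2 mu1 mu3].

Definition inf_M3 (c : R * R -> R) (mu1 mu2 mu3 : probability R R) : \bar R :=
  ereal_inf [set 'E_Q[fun w => c (w.1.1, w.2)] | Q in M3 mu1 mu2 mu3].

(* A probability is a total function on sets, whose values outside the
   sigma-algebra are irrelevant: M2, M3 and optimizers only constrain values on
   measurable sets, so uniqueness in them is to be read up to measure_eq. *)
Definition optimizers (c : R * R -> R) (mu1 mu3 : probability R R) :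
    set (probability (R * R)%type R) :=
  [set Q | M2 mu1 mu3 Q /\ 'E_Q[c] = inf_M2 c mu1 mu3].

End martingale_transport.

Section binomial_coupling.
Context (R : realType).
Local Open Scope ereal_scope.

Definition up_weight (Td Tu : R -> R) (x : R) : R :=
  ((x - Td x) / (Tu x - Td x) * \1_[set y | Td y < Tu y] x)%R.

Definition binomial_kernel (Td Tu : R -> R) (x : R) (B : set R) : \bar R :=
  (up_weight Td Tu x)%:E * \d_(Tu x) B +
  (1 - up_weight Td Tu x)%:E * \d_(Td x) B.

(* mu(dx) K(x, dy), with K = binomial_kernel Td Tu. *)
Definition binomial_coupling_fun (mu : probability R R) (Td Tu : R -> R)
    (A : set (R * R)) : \bar R :=
  \int[mu]_x binomial_kernel Td Tu x (xsection A x).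

Variables (mu : probability R R) (Td Tu : R -> R).
Hypotheses (mTd : measurable_fun [set: R] Td) (mTu : measurable_fun [set: R] Tu).
Hypotheses (Td_le : forall x, (Td x <= x)%R) (le_Tu : forall x, (x <= Tu x)%R).

Let up_weight_ge0 x : (0 <= up_weight Td Tu x)%R.
Proof.
rewrite /up_weight mulr_ge0// divr_ge0// subr_ge0//.
exact: le_trans (Td_le x) (le_Tu x).
Qed.

Let up_weight_le1 x : (0 <= 1 - up_weight Td Tu x)%R.
Proof.
rewrite subr_ge0 /up_weight indicE; case: (boolP (_ \in _)) => /=; last first.
  by rewrite mulr0.
rewrite inE/= => TduE; rewrite mulr1 ler_pdivrMr ?subr_gt0// mul1r.
by rewrite lerB.
Qed.

Let measurable_inv : measurable_fun [set: R] (@GRing.inv R).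
Proof.
have mN0 : measurable (~` [set 0%R] : set R) by exact: measurableC.
rewrite -(setUv [set 0%R : R]); apply/measurable_funU => //; split.
  exact: measurable_fun_set1.
apply: open_continuous_measurable_fun.
  by rewrite openC; exact/accessible_closed_set1/hausdorff_accessible/Rhausdorff.
by move=> x /set_mem/eqP; exact: inv_continuous.
Qed.

Let measurable_up_weight : measurable_fun [set: R] (up_weight Td Tu).
Proof.
have mD : measurable_fun [set: R] (fun x => (Tu x - Td x)%R).
  exact: measurable_funB.
apply: measurable_funM.
  apply: measurable_funM; first exact: measurable_funB.
  exact: (measurableT_comp measurable_inv).
apply: measurable_indic.
rewrite -[X in measurable X]setTI.
exact: (measurable_fun_ltr mTd mTu measurableT (Y := [set true])).
Qed.

Let binomial_kernelE x (A : set (R * R)) :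
  binomial_kernel Td Tu x (xsection A x) =
  (up_weight Td Tu x * \1_A (x, Tu x) +
   (1 - up_weight Td Tu x) * \1_A (x, Td x))%:E.
Proof.
rewrite /binomial_kernel !diracE EFinD !EFinM !indicE.
by rewrite !mem_xsection.
Qed.

Let binomial_kernel_ge0 x (B : set R) : 0 <= binomial_kernel Td Tu x B.
Proof. by rewrite adde_ge0// mule_ge0// lee_fin. Qed.

Let measurable_binomial_kernel (A : set (R * R)) : measurable A ->
  measurable_fun [set: R] (fun x => binomial_kernel Td Tu x (xsection A x)).
Proof.
move=> mA; under eq_fun do rewrite binomial_kernelE.
have mI (f : R -> R) : measurable_fun [set: R] f ->
    measurable_fun [set: R] (fun x => \1_A (x, f x) : R).
  move=> mf; apply: (measurableT_comp (measurable_indic _)) => //.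
  exact: measurable_fun_pair.
apply/measurable_EFinP; apply: measurable_funD; apply: measurable_funM => //.
- exact: mI.
- exact: measurable_funB.
- exact: mI.
Qed.

Let binomial_coupling0 : binomial_coupling_fun mu Td Tu set0 = 0.
Proof.
rewrite /binomial_coupling_fun integral0_eq// => x _.
by rewrite binomial_kernelE !indic0 !mulr0 addr0.
Qed.

Let binomial_coupling_ge0 A : 0 <= binomial_coupling_fun mu Td Tu A.
Proof. exact: integral_ge0. Qed.

Let binomial_coupling_sigma_additive :
  semi_sigma_additive (binomial_coupling_fun mu Td Tu).
Proof.
move=> F mF tF mUF; rewrite /binomial_coupling_fun.
pose K x : {measure set R -> \bar R} := measure_add
  (mscale (NngNum (up_weight_ge0 x)) \d_(Tu x))
  (mscale (NngNum (up_weight_le1 x)) \d_(Td x)).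
have KE x B : binomial_kernel Td Tu x B = K x B by rewrite /K/= /measure_add/= /msum 2!big_ord_recl big_ord0/= adde0.
rewrite [X in _ --> X](_ : _ =
    \int[mu]_x (\sum_(n <oo) binomial_kernel Td Tu x (xsection (F n) x))).
  rewrite integral_nneseries//; last first.
    by move=> n; exact: measurable_binomial_kernel.
  apply: is_cvg_nneseries => n _ _; exact: integral_ge0.
apply: eq_integral => x _; rewrite KE xsection_bigcup measure_semi_bigcup//=.
- by apply: eq_eseriesr => n _; rewrite KE.
- by move=> n; exact: measurable_xsection.
- exact: trivIset_xsection.
- by apply: bigcup_measurable => n _; exact: measurable_xsection.
Qed.

HB.instance Definition _ := isMeasure.Build _ _ _
  (binomial_coupling_fun mu Td Tu) binomial_coupling0 binomial_coupling_ge0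
  binomial_coupling_sigma_additive.

Let binomial_coupling_setT : binomial_coupling_fun mu Td Tu setT = 1.
Proof.
rewrite /binomial_coupling_fun (eq_integral (cst 1)).
  by rewrite integral_cst// mul1e; exact: probability_setT.
by move=> x _; rewrite binomial_kernelE !indicT !mulr1 addrC subrK.
Qed.

HB.instance Definition _ := Measure_isProbability.Build _ _ _
  (binomial_coupling_fun mu Td Tu) binomial_coupling_setT.

Definition binomial_coupling : probability (R * R)%type R :=
  binomial_coupling_fun mu Td Tu.

End binomial_coupling.

(* Main.v *)
(* If the infima agree, take a minimizing sequence in M3 and pass to the limit
   along an ultrafilter in the laws of (S1, S2) and of (S1, S3).  For couplings
   Q_n with fixed marginals, A |-> lim Q_n(A x ]-oo, t[) is a finitely additive
   set function dominated by the first marginal, hence has a density h_t(x);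
   the limit law is that of (x, inf {t | u < h_t(x)}) with u uniform.  The limit
   for (S1, S3) is optimal, hence is Q*.  Conditional Jensen gives, for
   phi(s) = max(+-(s - k), 0), E[1_A(S1) phi(S2)] <= E[1_A(S1) phi(S3)], and
   this survives the limit; with A = {Tu <= k} (resp. {k <= Td}) the right-hand
   side vanishes under Q*, so S2 lies between Td(S1) and Tu(S1) a.s.
   Conversely, given a law of (S1, S2) with this property, let S3 be Tu(S1) with
   conditional probability (S2 - Td) / (Tu - Td) and Td(S1) otherwise: this is a
   martingale, and averaging over S2 shows that (S1, S3) has law Q*. *)

Require Import Defs.
From HB Require Import structures.
From mathcomp Require Import all_boot all_order all_algebra.
From mathcomp Require Import all_classical all_reals all_analysis.
From mathcomp Require Import measurable_realfun giry.
From mathcomp Require Import lra ring.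

Set Implicit Arguments.
Unset Strict Implicit.
Unset Printing Implicit Defensive.
Import Order.TTheory GRing.Theory Num.Theory.
Import numFieldNormedType.Exports.

Local Open Scope classical_set_scope.
Local Open Scope ring_scope.

(** No limit of the three-period laws is taken: the hinge inequality compares the laws of (S1, S2)
    and (S1, S3) only, so it suffices that both pairs converge along the same ultrafilter. An
    ultrafilter makes all bounded real sequences converge at once, so no subsequence has to be
    extracted over the uncountable family of Borel sets A and levels t. Arbitrary A matters because
    Td and Tu are merely Borel: the events {Tu <= k} need not be continuity sets, and testing
    against continuous functions alone would lose them. Fixing the marginals does the rest: mass
    cannot escape to infinity, the limits are left-continuous in t, and finite first moments make
    tails small uniformly over all couplings, so that functions of linear growth (cost, coordinates,
    hinges) pass to the limit. In the converse the obstacle is the unbounded factor 1 / (Tu - Td),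
    which bars a direct use of the martingale identity when averaging over S2. *)

Section law.
Context d d' (T : measurableType d) (T' : measurableType d') (R : realType).
Context (P : probability T R) (X : T -> T') (mX : measurable_fun setT X).
Local Open Scope ereal_scope.

Definition law : probability T' R := distribution P (mfun_Sub (mem_set mX)).

Lemma lawE (A : set T') : law A = P (X @^-1` A).
Proof. by []. Qed.

Lemma integrable_law (f : T' -> \bar R) : measurable_fun setT f ->
  law.-integrable setT f <-> P.-integrable setT (f \o X).
Proof.
move=> mf; split=> [/integrableP[_ fi]|fi].
  apply/integrableP; split; first exact: measurableT_comp.
  move: fi; rewrite [X in X < _](_ : _ = \int[P]_x `|f (X x)|)//.
  by rewrite ge0_integral_distribution//; exact: measurableT_comp.
exact: integrable_pushforward.
Qed.

Lemma integral_law (D : set T') (f : T' -> \bar R) : measurable D ->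
  measurable_fun setT f -> P.-integrable setT (f \o X) ->
  \int[law]_(y in D) f y = \int[P]_(x in X @^-1` D) f (X x).
Proof.
move=> mD mf fi; rewrite integral_pushforward//.
apply: integrableS fi => //.
by rewrite -[_ @^-1` _]setTI; exact: mX.
Qed.

Lemma Rintegral_law (f : T' -> R) : measurable_fun setT f ->
  P.-integrable setT (fun x => (f (X x))%:E) ->
  (\int[law]_y f y = \int[P]_x f (X x))%R.
Proof.
move=> mf fi; rewrite /Rintegral; congr fine.
have := integral_law measurableT (measurableT_comp (@EFin_measurable R setT) mf)
  fi.
by rewrite preimage_setT.
Qed.

End law.
Arguments law : simpl never.

(** * Integrability and almost everywhere comparison *)

Lemma eq_measure_integrable d (T : measurableType d) (R : realType)
    (m1 m2 : {measure set T -> \bar R}) (f : T -> \bar R) :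
  (forall A, measurable A -> m1 A = m2 A) ->
  m1.-integrable setT f -> m2.-integrable setT f.
Proof.
move=> m12 /integrableP[mf fi]; apply/integrableP; split => //.
by rewrite -(@eq_measure_integral _ _ _ _ m2 m1)// => A mA _; exact: m12.
Qed.

Lemma le_integrableR d (T : measurableType d) (R : realType)
    (m : {measure set T -> \bar R}) (f g : T -> R) :
  measurable_fun setT f -> (forall x, `|f x| <= g x) ->
  m.-integrable setT (EFin \o g) -> m.-integrable setT (EFin \o f).
Proof.
move=> mf fg; apply: le_integrable => //; first exact/measurable_EFinP.
by move=> x _; rewrite lee_fin (le_trans (fg x))// ler_norm.
Qed.

Lemma integrable_indicM d (T : measurableType d) (R : realType)
    (m : {measure set T -> \bar R}) (A : set T) (f : T -> R) :
  measurable A -> m.-integrable setT (EFin \o f) ->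
  m.-integrable setT (EFin \o (fun x => \1_A x * f x)).
Proof.
move=> mA fi; have mf : measurable_fun setT f.
  by apply/measurable_EFinP; exact: measurable_int fi.
apply: (le_integrableR (g := fun x => `|f x|)).
- exact: measurable_funM.
- by move=> x; rewrite normrM indicE; case: (_ \in _);
    rewrite ?normr1 ?normr0 ?mul1r ?mul0r.
- exact: integrable_norm.
Qed.

Lemma integrable_hinge d (T : measurableType d) (R : realType)
    (P : probability T R) (X : T -> R) (e k : R) :
  P.-integrable setT (EFin \o X) ->
  P.-integrable setT (EFin \o (fun x => Num.max (e * (X x - k)) 0)).
Proof.
move=> Xi; have mX : measurable_fun setT X.
  by apply/measurable_EFinP; exact: measurable_int Xi.
apply: (le_integrableR (g := fun x => `|e| * `|X x| + `|e| * `|k|)).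
- apply: measurable_funrpos; apply: measurable_funM => //; exact: measurable_funB.
- move=> x; have : `|Num.max (e * (X x - k)) 0| <= `|e * (X x - k)|.
    by case: (leP (e * (X x - k)) 0) => _; rewrite ?normr0.
  move=> /le_trans; apply; rewrite normrM -mulrDr ler_wpM2l//.
  exact: ler_normB.
- apply: (@integrableD _ _ _ _ _ measurableT (fun x => (`|e| * `|X x|)%:E)
    (fun=> (`|e| * `|k|)%:E)).
  + apply: (@integrableZl _ _ _ _ _ measurableT `|e| (fun x => `|X x|%:E)).
    exact: integrable_norm.
  + exact: finite_measure_integrable_cst.
Qed.

Section has_law.
Context d (T : measurableType d) (R : realType).
Context (P : probability T R) (X : T -> R) (mu : probability R R).
Hypotheses (mX : measurable_fun setT X) (PX : has_law P X mu).
Local Open Scope ereal_scope.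

Lemma has_law_integrable (f : R -> \bar R) :
  mu.-integrable setT f -> P.-integrable setT (f \o X).
Proof.
move=> fi; apply/(integrable_law P mX); first exact: measurable_int fi.
by apply: eq_measure_integrable fi => A mA; exact/esym/PX.
Qed.

Lemma has_law_integral (f : R -> \bar R) :
  mu.-integrable setT f -> \int[P]_x f (X x) = \int[mu]_y f y.
Proof.
move=> fi; have mf := measurable_int _ fi.
have := integral_law mX measurableT mf (has_law_integrable fi).
rewrite preimage_setT => <-.
by apply: eq_measure_integral => A mA _; exact: PX.
Qed.

End has_law.

(** Listing the rationals by natural numbers lets countable unions and infima be indexed by [nat]; a
    code of no rational yields 0, which merely repeats a rational. *)
Definition rat_seq (R : realType) (n : nat) : R :=
  if unpickle n is Some q then ratr q else 0.

Lemma rat_seq_dense (R : realType) (s t : R) :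
  s < t -> exists n, s < rat_seq R n < t.
Proof.
move=> /rat_in_itvoo[q]; rewrite in_itv/= => sqt.
by exists (pickle q); rewrite /rat_seq pickleK.
Qed.

Lemma Rintegral_indicM d (T : measurableType d) (R : realType)
    (m : {measure set T -> \bar R}) (A : set T) (f : T -> R) :
  \int[m]_(x in A) f x = \int[m]_x (\1_A x * f x).
Proof.
rewrite Rintegral_mkcond; apply: eq_Rintegral => x _; rewrite patchE indicE.
by case: (_ \in _); rewrite ?mul1r ?mul0r.
Qed.

Section ae_le.
Context d (T : measurableType d) (R : realType) (mu : {measure set T -> \bar R}).
Local Open Scope ereal_scope.

(** On [E], where g < f, the assumed inequality and the pointwise one make the integrals of f and g
    agree over every measurable subset; hence f = g almost everywhere on [E], which contradicts g <
    f outside a null set. *)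
Lemma integral_measure_lt0 (f g : T -> \bar R) :
  mu.-integrable setT f -> mu.-integrable setT g ->
  (forall A, measurable A -> \int[mu]_(x in A) f x <= \int[mu]_(x in A) g x) ->
  mu [set x | g x < f x] = 0.
Proof.
move=> fi gi fg; set E := [set x | _].
have mf := measurable_int _ fi; have mg := measurable_int _ gi.
have mE : measurable E by rewrite -[E]setTI; exact: measurable_lte.
have fiE := integrableS measurableT mE (@subsetT _ E) fi.
have giE := integrableS measurableT mE (@subsetT _ E) gi.
suff : mu.-negligible E by move=> /(negligibleP _ mE).
have [B [mB B0 sB]] : {ae mu, forall x, E x -> f x = g x}.
  apply: integral_ae_eq => //; first exact: measurable_int giE.
  move=> A AE mA; apply/eqP; rewrite eq_le fg//=.
  apply: le_integral => //.
  - exact: integrableS gi.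
  - exact: integrableS fi.
  - by move=> x /set_mem /AE /ltW.
exists B; split => // x Ex; apply: sB => /(_ Ex) fgx.
by move: Ex; rewrite /E/= fgx ltxx.
Qed.

End ae_le.

Lemma le_measure_negligible d (T : measurableType d) (R : realType)
    (mu : {measure set T -> \bar R}) (A B N : set T) :
  measurable A -> measurable B -> mu.-negligible N -> A `<=` B `|` N ->
  (mu A <= mu B)%E.
Proof.
move=> mA mB [N' [mN' N'0 NN']] AB.
rewrite -[leRHS]adde0 -[X in (_ + X)%E]N'0 (le_trans _ (measureU2 _ mB mN'))//.
apply: le_measure; rewrite ?inE//; first exact: measurableU.
by apply: subset_trans AB _; exact: setUS.
Qed.

Lemma nonincreasing_measure_small d (T : measurableType d) (R : realType)
    (P : probability T R) (F : nat -> set T) (e : R) :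
  (forall n, measurable (F n)) -> nonincreasing_seq F -> \bigcap_n F n = set0 ->
  0 < e -> exists n, (P (F n) <= e%:E)%E.
Proof.
move=> mF niF F0 e0.
have := @nonincreasing_cvg_mu _ _ _ P F.
rewrite F0 measure0 => /(_ _ mF measurable0 niF) H.
have {}H : P \o F @ \oo --> (0 : \bar R)%E.
  have F0y : (P (F 0%N) < +oo)%E by rewrite (le_lt_trans (probability_le1 _ _))
    ?ltry.
  exact: H F0y.
have [n _ Hn] := cvgr_lt _ (fine_cvg H) _ e0.
exists n; rewrite -[leLHS]fineK ?fin_num_measure// lee_fin.
exact/ltW/(Hn n (leqnn n)).
Qed.

(** * Densities of dominated finitely additive set functions *)

Section density.
Context d (T : measurableType d) (R : realType) (mu : probability T R).
Variable m : set T -> R.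
Hypothesis m_ge0 : forall A, measurable A -> 0 <= m A.
Hypothesis m_le : forall A, measurable A -> ((m A)%:E <= mu A)%E.
Hypothesis mU : forall A B, measurable A -> measurable B -> A `&` B = set0 ->
  m (A `|` B) = m A + m B.

(** A measure has to be nonnegative on all sets, whereas [m] is controlled on measurable sets only;
    the maximum with 0 changes no value on measurable sets. *)
Let m' (A : set T) : \bar R := (Num.max 0 (m A))%:E.

Let m'E A : measurable A -> m' A = (m A)%:E.
Proof. by move=> mA; rewrite /m' (max_idPr _)// m_ge0. Qed.

Let m0 : m set0 = 0.
Proof.
apply/eqP; rewrite eq_le m_ge0// andbT -lee_fin.
by rewrite (le_trans (m_le measurable0))// measure0.
Qed.

Let m'0 : m' set0 = 0%E.
Proof. by rewrite m'E// m0. Qed.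

Let m'_ge0 A : (0 <= m' A)%E.
Proof. by rewrite lee_fin le_max lexx. Qed.

Let m_bigcup (F : (set T)^nat) n : (forall k,
  measurable (F k)) -> trivIset setT F ->
  m (\big[setU/set0]_(k < n) F k) = \sum_(k < n) m (F k).
Proof.
move=> mF tF; elim: n => [|n ih]; first by rewrite !big_ord0.
rewrite !big_ord_recr/= mU ?ih//; first exact: bigsetU_measurable.
by apply: (@trivIset_bigsetUI _ predT) => //; apply: sub_trivIset tF.
Qed.

(** By finite additivity the value of the union is a partial sum plus the value of the remainder.
    The latter is dominated by the [mu]-measure of the remainder, which decreases to 0. *)
Let m'_sigma_additive : semi_sigma_additive m'.
Proof.
move=> F mF tF mUF.
have mB n : measurable (\big[setU/set0]_(k < n) F k) by exact: bigsetU_measurable.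
have mD n : measurable (\bigcup_k F k `\` \big[setU/set0]_(k < n) F k).
  exact: measurableD.
have sB n : \big[setU/set0]_(k < n) F k `<=` \bigcup_k F k.
  rewrite -bigcup_mkord; apply: bigcup_sub => k _ x; by exists k.
have split_m n : m (\bigcup_k F k) = \sum_(k < n) m (F k) +
    m (\bigcup_k F k `\` \big[setU/set0]_(k < n) F k).
  rewrite -m_bigcup// -mU//; first by rewrite setDUK.
  by apply/seteqP; split => // x [? []].
have sum_m n : (\sum_(0 <= k < n) m' (F k) = (\sum_(k < n) m (F k))%:E)%E.
  by rewrite big_mkord -sumEFin; apply: eq_bigr => k _; rewrite m'E.
under eq_fun do rewrite sum_m.
rewrite m'E//; apply: cvg_EFin; first by near=> n.
have muD : (mu (\bigcup_k F k `\` \big[setU/set0]_(k < n) F k))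
    @[n --> \oo] --> (0 : \bar R)%E.
  have D0 : \bigcap_n (\bigcup_k F k `\` \big[setU/set0]_(k < n) F k) = set0.
    apply/seteqP; split => // x H; have [[k _ Fkx] _] := H 0%N I.
    by have [_] := H k.+1 I; apply; rewrite -bigcup_mkord; exists k => //=.
  have := @nonincreasing_cvg_mu _ _ _ mu
    (fun n => \bigcup_k F k `\` \big[setU/set0]_(k < n) F k).
  rewrite D0 measure0; apply => //.
  - by rewrite (le_lt_trans (probability_le1 _ _)) ?ltry.
  - by move=> a b ab; apply/subsetPset; apply: setDS; exact: subset_bigsetU.
have mD0 : m (\bigcup_k F k `\` \big[setU/set0]_(k < n) F k) @[n --> \oo] -->
  (0:R).
  suff /fine_cvg : (m (\bigcup_k F k `\` \big[setU/set0]_(k < n) F k))%:E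
    @[n --> \oo] --> (0%R)%:E by [].
  apply: (squeeze_cvge _ (cvg_cst _) muD); near=> n.
  by apply/andP; split; [rewrite lee_fin; exact: m_ge0|exact: m_le].
have -> : fine \o (fun n => (\sum_(k < n) m (F k))%:E) =
    (fun n => m (\bigcup_k F k) -
      m (\bigcup_k F k `\` \big[setU/set0]_(k < n) F k)).
  by apply/funext => n /=; rewrite (split_m n) addrK.
by rewrite -[X in _ --> X]subr0; exact: cvgB (cvg_cst _) mD0.
Unshelve. all: by end_near. Qed.

HB.instance Definition _ := isMeasure.Build _ _ _ m' m'0 m'_ge0
  m'_sigma_additive.

Let m'_fin : fin_num_fun m'.
Proof. by []. Qed.

HB.instance Definition _ := Measure_isFinite.Build _ _ _ m' m'_fin.

(** Radon-Nikodym gives a density [f]. Its integral over any A is at most [mu A], the integral of 1,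
    so [f] is at most 1 almost everywhere; truncation at 1 makes the bound hold everywhere, as
    needed to compare the density with a uniform variable. *)
Lemma dominated_content_density : exists h : T -> R,
  [/\ measurable_fun setT h, forall x, 0 <= h x <= 1 &
      forall A, measurable A -> (m A)%:E = (\int[mu]_(x in A) (h x)%:E)%E].
Proof.
have m'_dom : m' `<< mu.
  apply/null_content_dominatesP => A mA muA.
  by rewrite m'E//; apply/eqP; rewrite eq_le -{1}muA m_le//= lee_fin m_ge0.
have [f [f0 ffin fi mf]] := radon_nikodym_sigma_finite (mu := mu) m'_dom.
have mff := measurable_int _ fi.
have f1 : mu [set x | (1 < f x)%E] = 0%E.
  apply: (integral_measure_lt0 (g := cst 1%E)) => //.
    exact: finite_measure_integrable_cst.
  by move=> A mA; rewrite -mf// [X in (X <= _)%E](m'E mA) integral_cst// mul1e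
    m_le.
have mh : measurable_fun setT (fun x => Num.min (fine (f x)) 1).
  apply: measurable_minr => //.
  by apply/measurable_EFinP; apply: eq_measurable_fun mff => x _ /=;
    rewrite fineK.
exists (fun x => Num.min (fine (f x)) 1); split => //.
- by move=> x; rewrite ge_min lexx orbT le_min ler01 fine_ge0.
move=> A mA; rewrite -m'E// mf//; apply: ae_eq_integral => //.
- exact: measurable_funTS.
- by apply/measurable_EFinP; exact: measurable_funTS.
exists [set x | (1 < f x)%E]; split => //.
  by rewrite -[X in measurable X]setTI; exact: measurable_lte.
move=> x /= H; rewrite ltNge; apply/negP => fx1; apply: H => _.
by rewrite (min_idPl _) ?fineK// -lee_fin fineK.
Qed.

End density.

(** * Limits of couplings along an ultrafilter *)

Section uniform.
Context (R : realType).

Let mid : measurable_fun setT (idfun : measurableTypeR R -> R).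
Proof. by move=> _ A mA; rewrite setTI. Qed.

(* The carrier of [uniform_prob] is [measurableTypeR R], whose Borel structure
   is that of [R] under another display. *)
Definition unif : probability R R := law (uniform_prob (@ltr01 R)) mid.

End uniform.
Arguments unif {R} : simpl never.

Lemma unifE (R : realType) (r : R) : 0 <= r <= 1 -> unif `]-oo, r[%classic = r%:E.
Proof.
move=> /andP[r0 r1]; rewrite /unif/= /law/= /distribution/= /pushforward/=
  preimage_id /uniform_prob integral_uniform_pdf.
have -> : `]-oo, r[%classic `&` `[0, 1]%classic = `[0%R, r[%classic :> set R.
  apply/seteqP; split=> x /=; rewrite !in_itv/=.
    by move=> [-> /andP[-> _]].
  by move=> /andP[-> xr]; rewrite xr/= (ltW (lt_le_trans xr r1)).
rewrite (eq_integral (cst 1%E)); last first.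
  move=> x; rewrite inE/= in_itv/= => /andP[x0 xr].
  by rewrite /uniform_pdf x0 (ltW (lt_le_trans xr r1))/= subr0 invr1.
rewrite integral_cst//= mul1e lebesgue_measure_itv/= lte_fin.
by case: ltgtP r0 => // [_|<-] _; rewrite ?sube0.
Qed.

Section ultralimit.
Context (R : realType) (I : Type) (U : set_system I) {UU : UltraFilter U}.

(** The image [u @ U] is again an ultrafilter and contains the compact segment [[0, M]], so it
    converges. *)
Lemma ultra_cvg (u : I -> R) (M : R) : (forall i, 0 <= u i <= M) ->
  exists l : R, u @ U --> l.
Proof.
move=> uM.
have uU : UltraFilter (u @ U).
  split; first exact: fmap_proper_filter.
  move=> G GF sG; apply/seteqP; split => [A GA|]; last exact: sG.
  have [//|] := in_ultra_setVsetC (u @^-1` A) UU.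
  move=> UnA; exfalso; have /(filterI GA) : G (~` A) by exact: sG.
  by rewrite setICr => /filter_not_empty.
have := @segment_compact R 0 M; rewrite compact_ultra => /(_ _ uU).
case; first by apply: (@filterE _ U _ (u @^-1` `[0, M])) => i /=;
  rewrite in_itv/=; exact: uM.
by move=> l [_ ul]; exists l.
Qed.

End ultralimit.

Section coupling_limit.
Context d (T : measurableType d) (R : realType).
Context (U : set_system nat) {UU : UltraFilter U}.
Context (mu : probability T R) (nu : probability R R).
Variable Q : nat -> probability (T * R)%type R.
Hypothesis Qmu : forall i A, measurable A -> Q i (A `*` setT) = mu A.
Hypothesis Qnu : forall i B, measurable B -> Q i (setT `*` B) = nu B.

Let pr i A t := fine (Q i (A `*` `]-oo, t[)).

Let mX (A : set T) (t : R) : measurable A -> measurable (A `*` `]-oo, t[).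
Proof. by move=> mA; exact: measurableX. Qed.

Let prE i A t : measurable A -> (pr i A t)%:E = Q i (A `*` `]-oo, t[).
Proof. by move=> mA; rewrite fineK// fin_num_measure//; exact: mX. Qed.

Let pr_le i A t : measurable A -> ((pr i A t)%:E <= mu A)%E.
Proof.
move=> mA; rewrite prE// -(Qmu i mA) le_measure// ?inE;
  [exact: mX|exact: measurableX|].
by move=> [x y] [].
Qed.

(** The implication sits inside the existential so that the limit can be chosen as a total function
    of [A]; on nonmeasurable sets the chosen value is arbitrary. *)
Let L_ex A t : exists l : R, measurable A -> (fun i => pr i A t) @ U --> l.
Proof.
have [mA|nmA] := pselect (measurable A); last by exists 0.
have b i : 0 <= pr i A t <= 1; last first.
  by have [l Hl] := @ultra_cvg R nat U UU (fun i => pr i A t) 1 b; exists l.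
 rewrite fine_ge0//= -lee_fin prE//.
exact: (probability_le1 _ (mX t mA)).
Qed.

Let L A t := sval (cid (L_ex A t)).

Let cvgL A t : measurable A -> (fun i => pr i A t) @ U --> L A t.
Proof. by move=> mA; exact: (svalP (cid (L_ex A t))). Qed.

Let L_ge0 A t : measurable A -> 0 <= L A t.
Proof.
move=> mA; apply: (ler_cvg_to (cvg_cst _) (cvgL mA)); apply: nearW => i;
  exact: fine_ge0.
Qed.

Let L_le A t : measurable A -> ((L A t)%:E <= mu A)%E.
Proof.
move=> mA; rewrite -[leRHS]fineK ?fin_num_measure// lee_fin.
apply: (ler_cvg_to (cvgL mA) (cvg_cst _)); apply: nearW => i.
by rewrite -lee_fin [leRHS]fineK ?fin_num_measure//; exact: (pr_le i t mA).
Qed.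

Let L_setU t A B : measurable A -> measurable B -> A `&` B = set0 ->
  L (A `|` B) t = L A t + L B t.
Proof.
move=> mA mB AB; have mAB := measurableU _ _ mA mB.
apply: (cvg_unique (@Rhausdorff R) (cvgL mAB)).
rewrite [X in X @ _](_ : _ = (fun i => pr i A t + pr i B t)); last first.
  apply/funext => i; apply: EFin_inj; rewrite EFinD !prE//.
  rewrite -measureU//; [|exact: mX|exact: mX|].
    by congr (Q i _); apply/seteqP; split => -[x y] /=; tauto.
  by rewrite -setXI AB setIid set0X.
exact: cvgD (cvgL mA) (cvgL mB).
Qed.

Let L_mono A s t : measurable A -> s <= t -> L A s <= L A t.
Proof.
move=> mA st; apply: (ler_cvg_to (cvgL mA) (cvgL mA)); apply: nearW => i.
rewrite -lee_fin !prE// le_measure ?inE//; [exact: mX|exact: mX|].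
by apply: setSX => // x /=; rewrite !in_itv/= => /lt_le_trans; apply.
Qed.

(** The bound holds for every [Q i] because the second marginal is always [nu]. It survives the
    limit and makes [L A t] left-continuous in t. *)
Let L_cont A s t : measurable A -> s <= t ->
  L A t <= L A s + fine (nu `[s, t[%classic).
Proof.
move=> mA st.
apply: (ler_cvg_to (cvgL mA) (cvgD (cvgL mA) (cvg_cst _))); apply: nearW => i.
rewrite -lee_fin EFinD !prE// fineK ?fin_num_measure//.
rewrite -(Qnu i)//.
have mst : measurable ([set: T] `*` `[s, t[%classic) by exact: measurableX.
apply: le_trans (measureU2 _ (mX s mA) mst).
rewrite le_measure ?inE//; [exact: mX|by apply: measurableU => //; exact: mX|].
move=> [x y] [/= Ax]; rewrite !in_itv/= => yt.
by have [ys|sy] := ltP y s; [left|right]; split => //=; rewrite in_itv/= ?ys ?sy.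
Qed.

Let L_nu t : L setT t = fine (nu `]-oo, t[%classic).
Proof.
apply: (cvg_unique (@Rhausdorff R) (cvgL measurableT)).
have -> : (fun i => pr i setT t) = fun=> fine (nu `]-oo, t[%classic).
  by apply/funext => i; rewrite /pr Qnu.
exact: cvg_cst.
Qed.

Let h_ex t : exists h : T -> R, [/\ measurable_fun setT h, forall x,
  0 <= h x <= 1 &
      forall A, measurable A -> (L A t)%:E = (\int[mu]_(x in A) (h x)%:E)%E].
Proof.
apply: (@dominated_content_density _ _ _ mu (fun A => L A t)) => *;
  [exact: L_ge0|exact: L_le|exact: L_setU].
Qed.

Let h t := sval (cid (h_ex t)).
Let mh t : measurable_fun setT (h t).
Proof. by have [] := svalP (cid (h_ex t)). Qed.
Let h01 t x : 0 <= h t x <= 1.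
Proof. by have [_ + _] := svalP (cid (h_ex t)); exact. Qed.
Let Lh t A : measurable A -> (L A t)%:E = (\int[mu]_(x in A) (h t x)%:E)%E.
Proof. by have [_ _] := svalP (cid (h_ex t)); exact. Qed.

Let PI : probability (T * R)%type R := (mu \x unif)%E.

Let PIX A B : measurable A -> measurable B -> PI (A `*` B) = (mu A * unif B)%E.
Proof. by move=> mA mB; exact: product_measure1E. Qed.

(** The region under the graph of [h t]: its section at x has uniform probability [h t x], the
    intended conditional probability of []-oo, t[] given x. *)
Let E t := [set z : T * R | z.2 < h t z.1].

Let mE t : measurable (E t).
Proof.
rewrite -[E t]setTI.
apply: (measurable_fun_ltr _ _ measurableT (Y := [set true])) => //.
by apply: measurableT_comp => //; exact: measurable_fst.
Qed.

Let PIE A t : measurable A -> PI (A `*` setT `&` E t) = (L A t)%:E.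
Proof.
move=> mA; rewrite Lh// /PI/= /product_measure1 [RHS]integral_mkcond/=.
apply: eq_integral => x _; rewrite /= patchE; case: ifPn => [xA|xA].
  rewrite -unifE//; congr (unif _); apply/seteqP; split => u;
    rewrite /xsection/= inE/= in_itv/=.
    by move=> [].
  by move=> ux; split => //; split => //; exact/set_mem.
rewrite (_ : xsection _ x = set0) ?measure0//; apply/seteqP; split => u //.
by rewrite /xsection/= inE/= => -[[/= /mem_set]]; rewrite (negbTE xA).
Qed.

Let mAT (A : set T) : measurable A -> measurable (A `*` [set: R]).
Proof. by move=> mA; exact: measurableX. Qed.

Let mATI (A : set T) B : measurable A -> measurable B -> measurable (A `*` [set:
  R] `&` B).
Proof. by move=> mA mB; apply: measurableI => //; exact: mAT. Qed.

(** The densities are chosen separately for each t, so monotonicity of [L A] in t gives [h s <= h t]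
    only [mu]-almost everywhere. *)
Let PI_mono s t : s <= t -> PI.-negligible (E s `\` E t).
Proof.
move=> st.
have hst : mu [set x | ((h t x)%:E < (h s x)%:E)%E] = 0%E.
  have hi r : mu.-integrable setT (fun x => (h r x)%:E).
    apply: (@le_integrable _ _ _ _ _ measurableT _ (cst 1%E)).
    - exact/measurable_EFinP.
    - move=> x _ /=; rewrite lee_fin normr1 ger0_norm; by have /andP[] := h01 r x.
    - exact: finite_measure_integrable_cst.
  apply: integral_measure_lt0 => // A mA; rewrite -!Lh// lee_fin; exact: L_mono.
have mS : measurable [set x | ((h t x)%:E < (h s x)%:E)%E].
  rewrite -[X in measurable X]setTI; apply: measurable_lte => //;
    exact/measurable_EFinP.
exists ([set x | ((h t x)%:E < (h s x)%:E)%E] `*` setT); split.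
- exact: mAT.
- by rewrite (PIX mS measurableT) [X in (X * _)%E]hst mul0e.
- move=> [x u] [/= us /negP]; rewrite -leNgt => tu.
  by split => //=; rewrite lte_fin (le_lt_trans tu us).
Qed.

Let r : nat -> R := @rat_seq R.

(** Only countably many densities enter, and [V t] grows with t at every point, not just almost
    everywhere; it turns out to be exactly the event that the variable [Y] below is less than t. *)
Let V t := \bigcup_(n in [set n | r n < t]) E (r n).

Let mV t : measurable (V t).
Proof. by apply: bigcup_measurable => n _. Qed.

(** Upper bound: [V t] exceeds [E t] by a countable union of the null sets of [PI_mono]. Lower
    bound: a rational between s and t loses at most the [nu]-mass of [[s, t[], by [L_cont], and this
    mass is small for s close to t. *)
Let PIV A t : measurable A -> PI (A `*` setT `&` V t) = (L A t)%:E.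
Proof.
move=> mA; apply/eqP; rewrite eq_le; apply/andP; split.
  rewrite -(PIE t mA); apply: (@le_measure_negligible _ _ _ _ _ _ (V t `\` E t)).
  - exact: mATI.
  - exact: mATI.
  - have : PI.-negligible (\bigcup_n (if r n < t then E (r n) `\` E t else set0)).
      apply: negligible_bigcup => n; case: ifPn => rt;
        last exact: negligible_set0.
      exact: PI_mono (ltW rt).
    apply: negligibleS => z [[n /= rnt En] nEt]; exists n => //.
    by rewrite rnt.
  - by move=> z [zA zV]; have [zE|zE] := pselect (E t z); [left|right].
apply/lee_addgt0Pr => _/posnumP[e].
have [s st se] : exists2 s, s < t & fine (nu `[s, t[%classic) <= e%:num.
  pose F n := `[t - n.+1%:R^-1, t[%classic : set R.
  have [n Fn] : exists n, (nu (F n) <= e%:num%:E)%E.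
    apply: (@nonincreasing_measure_small _ _ _ nu F) => //.
    - by move=> n; exact: measurable_itv.
    - move=> a b ab; apply/subsetPset => x; rewrite /F/= !in_itv/= => /andP[bx
        ->].
      by rewrite andbT (le_trans _ bx)// lerD2l lerN2 lef_pV2 ?posrE// ler_nat.
    - apply/seteqP; split => // x Fx.
      have : x < t by have := Fx 0%N I; rewrite /F/= in_itv/= => /andP[].
      move=> /ltr_add_invr[k]; rewrite -ltrBrDr => xk.
      have := Fx k I; rewrite /F/= in_itv/= => /andP[+ _].
      by rewrite leNgt xk.
  exists (t - n.+1%:R^-1); first by rewrite ltrBlDr ltrDl invr_gt0.
  by rewrite -lee_fin fineK ?fin_num_measure.
have [n /andP[sn nt]] := rat_seq_dense st.
apply: (@le_trans _ _ (L A (r n) + e%:num)%:E).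
  rewrite lee_fin (le_trans (L_cont mA (ltW st)))// lerD//.
  exact: L_mono (ltW sn).
rewrite EFinD leeD2r// -(PIE (r n) mA) le_measure ?inE//;
  [exact: mATI|exact: mATI|].
by apply: setIS => z Ez; exists n.
Qed.

(* For u uniform, Y (x, u) has the conditional distribution function
   t |-> h t x given x. *)
Let Y (z : T * R) : \bar R :=
  einfs (fun n => if z.2 < h (r n) z.1 then (r n)%:E else +oo%E) 0%N.

Let mY : measurable_fun setT Y.
Proof.
have := @measurable_fun_einfs _ _ R setT
  (fun n (z : T * R) => if z.2 < h (r n) z.1 then (r n)%:E else +oo%E).
move=> /(_ _ 0%N); apply=> n.
apply: measurable_fun_ifT => //.
apply: measurable_fun_ltr => //.
by apply: measurableT_comp => //; exact: measurable_fst.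
Qed.

Let YE t : [set z | (Y z < t%:E)%E] = V t.
Proof.
apply/seteqP; split => [z /ereal_inf_lt[_ [n _ <-]]|z [n /= rt Ez]].
  case: ifPn => // Ez; rewrite lte_fin => rt.
  by exists n.
apply: le_lt_trans (_ : (r n)%:E < t%:E)%E; last by rewrite lte_fin.
by apply: ereal_inf_lbound; exists n => //=; rewrite Ez.
Qed.

Let PIY t : PI [set z | (Y z < t%:E)%E] = nu `]-oo, t[%classic.
Proof.
by rewrite YE -[V t]setTI -setXTT PIV// L_nu fineK// fin_num_measure.
Qed.

Let mYB (B : set (\bar R)) : measurable B -> measurable (Y @^-1` B).
Proof. by move=> mB; rewrite -[_ @^-1` _]setTI; exact: mY. Qed.

Let null_of_small S : measurable S ->
  (forall e : R, 0 < e -> (PI S <= e%:E)%E) -> PI.-negligible S.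
Proof.
move=> mS S0; exists S; split => //; apply/eqP.
rewrite -measure_le0; apply/lee_addgt0Pr => e e0; rewrite add0e; exact: S0.
Qed.

(** On this event [Y] lies below [- n] for all n, and the left tails of [Y] are those of [nu]: the
    fixed second marginal keeps mass from escaping to infinity. *)
Let PI_Noo : PI.-negligible (Y @^-1` [set -oo%E]).
Proof.
apply: null_of_small; first exact: mYB.
move=> e e0.
have [n] : exists n, (nu `]-oo, (- n%:R)%R[%classic <= e%:E)%E.
  apply: (@nonincreasing_measure_small _ _ _ nu
    (fun n => `]-oo, (- n%:R)%R[%classic)) => //.
  - move=> a b ab; apply/subsetPset => x /=; rewrite !in_itv/= => /lt_le_trans;
      apply.
    by rewrite lerN2 ler_nat.
  - apply/seteqP; split => // x Fx.
    have := Fx (Num.truncn (- x)).+1 I; rewrite /= in_itv/= ltrNr => /ltW.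
    by rewrite leNgt; have := truncnS_gt (- x) => ->.
apply: le_trans; rewrite -PIY YE le_measure ?inE//; first exact: mYB.
by rewrite -YE => z /= ->; exact: ltNyr.
Qed.

Let PI_oo : PI.-negligible (Y @^-1` [set +oo%E]).
Proof.
apply: null_of_small; first exact: mYB.
move=> e e0.
have [n] : exists n, (nu `[n%:R, +oo[%classic <= e%:E)%E.
  apply: (@nonincreasing_measure_small _ _ _ nu
    (fun n => `[n%:R, +oo[%classic)) => //.
  - move=> a b ab; apply/subsetPset => x /=; rewrite !in_itv/= !andbT;
      apply: le_trans.
    by rewrite ler_nat.
  - apply/seteqP; split => // x Fx.
    have := Fx (Num.truncn x).+1 I; rewrite /= in_itv/= andbT.
    by rewrite leNgt; have := truncnS_gt x => ->.
apply: le_trans; rewrite -[X in nu X]setCitvl probability_setC// -PIY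
  -probability_setC.
  rewrite le_measure ?inE//; first exact: mYB.
    by rewrite YE; exact: measurableC.
  by move=> z /= ->.
by rewrite YE.
Qed.

(** [fine] sends infinite values of [Y] to 0; by [PI_Noo] and [PI_oo] this affects a null set
    only. *)
Let X (z : T * R) : T * R := (z.1, fine (Y z)).

Let mXX : measurable_fun setT X.
Proof.
apply: measurable_fun_pair; first exact: measurable_fst.
exact: (measurableT_comp (fine_measurable measurableT) mY).
Qed.

(** The witness is the law of [X] under [PI]. It gives A x []-oo, t[] exactly the ultralimit
    [L A t], for every Borel A and every t without a continuity condition, because these limits are
    left-continuous in t. *)
Lemma coupling_ultralimit : exists P : probability (T * R)%type R,
  [/\ forall A, measurable A -> P (A `*` setT) = mu A,
      forall B, measurable B -> P (setT `*` B) = nu B &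
      forall A t, measurable A ->
        (fun n => fine (Q n (A `*` `]-oo, t[))) @ U --> fine (P (A `*` `]-oo,
          t[))].
Proof.
pose P := law PI mXX.
have PV A t : measurable A -> P (A `*` `]-oo, t[) = (L A t)%:E.
  move=> mA; rewrite -(PIV t mA).
  rewrite lawE.
  have mXA : measurable (X @^-1` (A `*` `]-oo, t[)).
    by rewrite -[_ @^-1` _]setTI; apply: mXX => //; exact: mX.
  have neg : PI.-negligible (Y @^-1` [set -oo%E] `|` Y @^-1` [set +oo%E]).
    exact: negligibleU PI_Noo PI_oo.
  apply/eqP; rewrite eq_le; apply/andP; split.
    apply: (le_measure_negligible mXA _ neg); first exact: mATI.
    move=> z [/= zA]; rewrite in_itv/= => zt.
    have [Yfin|] := boolP (Y z \is a fin_num); last first.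
      by rewrite fin_numE negb_and !negbK => /orP[/eqP|/eqP]; right; [left|right].
    by left; split => //; rewrite -YE/= -[Y z]fineK// lte_fin.
  apply: (le_measure_negligible _ mXA neg); first exact: mATI.
  rewrite -YE => z [[/= zA _]] zt.
  have [Yfin|] := boolP (Y z \is a fin_num); last first.
    by rewrite fin_numE negb_and !negbK => /orP[/eqP|/eqP]; right; [left|right].
  by left; split => //=; rewrite in_itv/= -lte_fin fineK.
exists P; split.
- move=> A mA; rewrite lawE (_ : X @^-1` _ = A `*` setT).
    by rewrite (PIX mA measurableT) probability_setT mule1.
  by apply/seteqP; split => -[].
- move=> B mB.
  have H : forall B, measurable B -> law P measurable_snd B = nu B.
    have HG := @measure_unique _ R R (@RGenInftyO.G R)
      (fun n => `]-oo, n%:R[%classic) (RGenInftyO.measurableE R) _ _ _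
      (law P measurable_snd) nu.
    apply: HG.
    + move=> _ _ [a ->] [b ->]; exists (Num.min a b); apply/seteqP.
      by split=> x /=; rewrite !in_itv/= lt_min => /andP.
    + by move=> n; exists n%:R.
    + apply/seteqP; split => // x _; exists (Num.truncn x).+1 => //=.
      by rewrite in_itv/= truncnS_gt.
    + move=> _ [t ->]; transitivity (P (setT `*` `]-oo, t[)).
        by rewrite -[LHS]/(P (snd @^-1` _)); congr (P _); apply/seteqP;
          split => -[x y] //= [].
      by rewrite PV// L_nu fineK// fin_num_measure.
    + by move=> n; rewrite (le_lt_trans (probability_le1 _ _)) ?ltry.
  rewrite -(H B mB) lawE; congr (P _); apply/seteqP; by split => -[x y] //= [].
- by move=> A t mA; rewrite PV//; exact: cvgL.
Qed.

End coupling_limit.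

(** * Martingale laws *)

Section filtration.
Context d (T : measurableType d) (R : realType) (n : nat) (X : 'I_n -> T -> R).
Local Open Scope ereal_scope.

Lemma natural_filtration_preimage (j i : 'I_n) (B : set R) :
  (i <= j)%N -> measurable B -> natural_filtration X j (X i @^-1` B).
Proof.
move=> ij mB; apply: sub_sigma_algebra.
have ij' : (i < j.+1)%N by [].
rewrite (bigD1 (Ordinal ij'))//=; left; exists B => //; rewrite setTI.
by rewrite (_ : widen_ord _ _ = i)//; exact: val_inj.
Qed.

Lemma natural_filtration_setI (j : 'I_n) : setI_closed (natural_filtration X j).
Proof. by move=> A B; exact: (@measurableI _ (g_sigma_algebraType _) A B). Qed.

(** The inclusion need only be checked on the generators, the events of a single [X i], which are
    preimages under [g] once [X i] factors through [g]. *)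
Lemma natural_filtration_sub d' (T' : measurableType d') (g : T -> T') (j :
  'I_n) :
  (forall i : 'I_n, (i <= j)%N -> exists2 phi : T' -> R,
     measurable_fun setT phi & X i = phi \o g) ->
  natural_filtration X j `<=` preimage_set_system setT g measurable.
Proof.
move=> Xg; apply: smallest_sub.
  exact/sigma_algebra_preimage/sigma_algebra_measurable.
apply: (big_ind (fun S : set (set T) => S `<=` _)) => //.
- by move=> S1 S2 sS1 sS2 A [/sS1|/sS2].
- move=> i _ A [B mB <-].
  have [|phi mphi ->] := Xg (widen_ord (ltn_ord j) i); first by rewrite /= -ltnS.
  exists (phi @^-1` B); last by rewrite comp_preimage.
  by rewrite -[_ @^-1` _]setTI; exact: mphi.
Qed.

Lemma mk_martingale (P : probability T R) :
  (forall k, P.-integrable setT (EFin \o X k)) ->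
  (forall (j k : 'I_n) A, (j < k)%N -> natural_filtration X j A ->
    \int[P]_(w in A) (X j w)%:E = \int[P]_(w in A) (X k w)%:E) ->
  martingale P X.
Proof.
move=> Xi XE; split=> // j k; rewrite leq_eqVlt => /predU1P[/val_inj <-|jk];
  split => //.
- by move=> B mB; exact: natural_filtration_preimage.
- by move=> B mB; exact: natural_filtration_preimage.
- by move=> A; exact: XE.
Qed.

End filtration.

Section two_periods.
Context (R : realType) (mu nu : probability R R).
Hypotheses (hmu : finite_first_moment mu) (hnu : finite_first_moment nu).
Implicit Type Q : probability (R * R)%type R.

Definition coupling Q := has_law Q fst mu /\ has_law Q snd nu.

Lemma coupling_integrable1 Q (f : R -> R) : coupling Q ->
  mu.-integrable setT (EFin \o f) -> Q.-integrable setT (fun w => (f w.1)%:E).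
Proof.
by move=> [Qmu _] fi; apply: (has_law_integrable measurable_fst Qmu fi).
Qed.

Lemma coupling_integrable2 Q (f : R -> R) : coupling Q ->
  nu.-integrable setT (EFin \o f) -> Q.-integrable setT (fun w => (f w.2)%:E).
Proof.
by move=> [_ Qnu] fi; apply: (has_law_integrable measurable_snd Qnu fi).
Qed.

(** The sigma-algebra generated by the first coordinate consists of preimages under [fst], so the
    martingale property becomes a family of identities between integrals, a form that passes to
    limits. *)
Lemma M2P Q : M2 mu nu Q <-> coupling Q /\
  forall A, measurable A ->
    (\int[Q]_(w in fst @^-1` A) w.1%:E = \int[Q]_(w in fst @^-1` A) w.2%:E)%E.
Proof.
split=> [[Qmu Qnu [_ QE]]|[[Qmu Qnu] QE]].
  split=> // A mA; have [//|_ _] := QE ord0 ord_max.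
  by apply; exact: (@natural_filtration_preimage _ _ R _ (@coords2 R) ord0 ord0
    A).
split=> //; apply: mk_martingale => [[[|[|//]] ?]|[[|[|//]] ?] [[|[|//]] ?] //=
  A _ FA].
- exact: (@coupling_integrable1 _ id).
- exact: (@coupling_integrable2 _ id).
- have [|B mB <-] := natural_filtration_sub (g := fst) _ FA.
    by case=> [[|//] ?] _; exists id => //; apply/funext.
  by rewrite setTI; exact: QE.
Qed.

End two_periods.

Section three_periods.
Context (R : realType) (mu1 mu2 mu3 : probability R R).
Hypotheses (hmu1 : finite_first_moment mu1) (hmu2 : finite_first_moment mu2)
  (hmu3 : finite_first_moment mu3).
Implicit Type Q : probability (R * R * R)%type R.

Definition proj12 (w : R * R * R) : R * R := w.1.
Definition proj13 (w : R * R * R) : R * R := (w.1.1, w.2).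

Lemma measurable_proj12 : measurable_fun setT proj12.
Proof. exact: measurable_fst. Qed.

Lemma measurable_w11 : measurable_fun setT (fun w : R * R * R => w.1.1).
Proof. exact: (measurableT_comp measurable_fst measurable_fst). Qed.

Lemma measurable_w12 : measurable_fun setT (fun w : R * R * R => w.1.2).
Proof. exact: (measurableT_comp measurable_snd measurable_fst). Qed.

Lemma measurable_proj13 : measurable_fun setT proj13.
Proof. exact: measurable_fun_pair measurable_w11 measurable_snd. Qed.

Let Q1 Q : has_law Q (fun w => w.1.1) mu1 -> Q.-integrable setT (fun w =>
  w.1.1%:E).
Proof. by move=> h; exact: (has_law_integrable measurable_w11 h hmu1). Qed.

Let Q2 Q : has_law Q (fun w => w.1.2) mu2 -> Q.-integrable setT (fun w =>
  w.1.2%:E).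
Proof. by move=> h; exact: (has_law_integrable measurable_w12 h hmu2). Qed.

Let Q3 Q : has_law Q snd mu3 -> Q.-integrable setT (fun w => w.2%:E).
Proof. by move=> h; exact: (has_law_integrable measurable_snd h hmu3). Qed.

Lemma mk_M3 Q :
  has_law Q (fun w => w.1.1) mu1 -> has_law Q (fun w => w.1.2) mu2 ->
  has_law Q snd mu3 ->
  (forall A, measurable A -> \int[Q]_(w in (fun w => w.1.1) @^-1` A) w.1.1%:E =
    \int[Q]_(w in (fun w => w.1.1) @^-1` A) w.1.2%:E)%E ->
  (forall A, measurable A -> \int[Q]_(w in proj12 @^-1` A) w.1.2%:E =
    \int[Q]_(w in proj12 @^-1` A) w.2%:E)%E ->
  M3 mu1 mu2 mu3 Q.
Proof.
move=> h1 h2 h3 h12 h23; split=> //.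
have F0 (j : 'I_3) A : j = 0%N :> nat -> natural_filtration (@coords3 R) j A ->
    exists2 B, measurable B & A = (fun w => w.1.1) @^-1` B.
  move=> j0 FA.
  have [|B mB <-] := natural_filtration_sub (g := fun w : R * R * R => w.1.1) _
    FA.
    by rewrite j0; case=> [[|//] ?] _; exists id => //; apply/funext.
  by exists B => //; rewrite setTI.
apply: mk_martingale => [[[|[|[|//]]] ?]|[[|[|[|//]]] ?] [[|[|[|//]]] ?] //= A _
  FA].
- exact: Q1.
- exact: Q2.
- exact: Q3.
- by have [//|B mB ->] := F0 _ _ _ FA; exact: h12.
- have [//|B mB ->] := F0 _ _ _ FA.
  (* First and third times: the identity from S1 to S2, followed by the one from S2 to S3 on the
     cylinder over B x R. *)
  rewrite [LHS]h12//.
  have -> : (fun w : R * R * R => w.1.1) @^-1` B = proj12 @^-1` (B `*` setT).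
    by apply/seteqP; split => -[[x y] z] //= [].
  by apply: h23; exact: measurableX.
- have [|B mB <-] := natural_filtration_sub (g := proj12) _ FA.
    case=> [[|[|//]] ?] _; [exists fst|exists snd] => //; apply/funext.
  by rewrite setTI; exact: h23.
Qed.

Context Q (hQ : M3 mu1 mu2 mu3 Q).

Lemma law_proj12_M2 : M2 mu1 mu2 (law Q measurable_proj12).
Proof.
case: hQ => h1 h2 h3 [_ QE]; apply/M2P => //; split; first by split.
move=> A mA.
have mA1 : measurable (fst @^-1` A : set (R * R)).
  by rewrite -[_ @^-1` _]setTI; exact: measurable_fst.
have e1 := integral_law measurable_proj12 mA1
  (measurableT_comp (@EFin_measurable R setT) measurable_fst) (Q1 h1).
have e2 := integral_law measurable_proj12 mA1
  (measurableT_comp (@EFin_measurable R setT) measurable_snd) (Q2 h2).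
apply: (eq_trans e1); apply: (eq_trans _ (esym e2)).
have [//|_ _] := QE ord0 (Ordinal (isT : 1 < 3)%N).
by apply; exact: (@natural_filtration_preimage _ _ R _ (@coords3 R) ord0 ord0 A).
Qed.

Lemma law_proj13_M2 : M2 mu1 mu3 (law Q measurable_proj13).
Proof.
case: hQ => h1 h2 h3 [_ QE]; apply/M2P => //; split; first by split.
move=> A mA.
have mA1 : measurable (fst @^-1` A : set (R * R)).
  by rewrite -[_ @^-1` _]setTI; exact: measurable_fst.
have e1 := integral_law measurable_proj13 mA1
  (measurableT_comp (@EFin_measurable R setT) measurable_fst) (Q1 h1).
have e2 := integral_law measurable_proj13 mA1
  (measurableT_comp (@EFin_measurable R setT) measurable_snd) (Q3 h3).
apply: (eq_trans e1); apply: (eq_trans _ (esym e2)).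
have [//|_ _] := QE ord0 ord_max.
by apply; exact: (@natural_filtration_preimage _ _ R _ (@coords3 R) ord0 ord0 A).
Qed.

Lemma M3_integral_eq A B : measurable A -> measurable B ->
  (\int[Q]_(w in (fun w => w.1.1) @^-1` A `&` (fun w => w.1.2) @^-1` B) w.1.2%:E =
   \int[Q]_(w in (fun w => w.1.1) @^-1` A `&` (fun w => w.1.2) @^-1` B) w.2%:E)%E.
Proof.
case: hQ => h1 h2 h3 [_ QE] mA mB.
have o1 : (inord 1 : 'I_3) = Ordinal (isT : 1 < 3)%N.
  by apply/val_inj; rewrite /= inordK.
have [//|_ _] := QE (Ordinal (isT : 1 < 3)%N) ord_max.
apply.
apply: natural_filtration_setI.
- exact: (@natural_filtration_preimage _ _ R _ (@coords3 R) _ ord0 A).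
- exact: (@natural_filtration_preimage _ _ R _ (@coords3 R) _ (Ordinal (isT : 1
    < 3)%N) B).
Qed.

(* Conditional Jensen inequality for z given (x, y). *)
Lemma M3_hinge_le A (e k : R) : measurable A ->
  \int[law Q measurable_proj12]_w (\1_A w.1 * Num.max (e * (w.2 - k)) 0) <=
  \int[law Q measurable_proj13]_w (\1_A w.1 * Num.max (e * (w.2 - k)) 0).
Proof.
move=> mA; have [h1 h2 h3 _] := hQ.
set g := fun y : R => Num.max (e * (y - k)) 0.
have mg : measurable_fun setT g.
  by apply: measurable_funrpos; apply: measurable_funM => //;
    exact: measurable_funB.
have mf : measurable_fun setT (fun w : R * R => \1_A w.1 * g w.2).
  apply: measurable_funM; last exact: measurableT_comp.
  by apply: measurableT_comp => //; exact: measurable_indic.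
have mA1 : measurable ((fun w : R * R * R => w.1.1) @^-1` A).
  by rewrite -[_ @^-1` _]setTI; exact: measurable_w11.
have i2 := integrable_indicM mA1 (integrable_hinge e k (Q2 h2)).
have i3 := integrable_indicM mA1 (integrable_hinge e k (Q3 h3)).
have r2 := Rintegral_law measurable_proj12 mf i2.
have r3 := Rintegral_law measurable_proj13 mf i3.
rewrite [leLHS]r2 [leRHS]r3.
(* On [S], an event of the first two coordinates, the hinge of y is affine, and the martingale
   property lets z replace y there. Off [S] the left-hand integrand vanishes and the right-hand one
   is nonnegative. *)
set B := [set y : R | 0 < e * (y - k)].
have mB : measurable B.
  rewrite -[B]setTI; apply: (measurable_fun_ltr _ _ measurableT (Y := [set
    true])) => //.
  by apply: measurable_funM => //; exact: measurable_funB.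
set S := (fun w : R * R * R => w.1.1) @^-1` A `&` (fun w => w.1.2) @^-1` B.
have mS : measurable S.
  apply: measurableI => //; rewrite -[_ @^-1` _]setTI; exact: measurable_w12.
have memS w : (w \in S) = (w.1.1 \in A) && (0 < e * (w.1.2 - k)).
  apply/idP/idP => [/set_mem[a b]|/andP[/set_mem a b]]; last exact/mem_set.
  by rewrite mem_set.
have affine (X : R * R * R -> R) : Q.-integrable setT (EFin \o X) ->
    \int[Q]_(w in S) (e * (X w - k)) =
    e * \int[Q]_(w in S) X w - e * k * fine (Q S).
  move=> Xi; have XiS := integrableS measurableT mS (@subsetT _ S) Xi.
  have kiS : Q.-integrable S (EFin \o (fun=> k)).
    exact: finite_measure_integrable_cst.
  rewrite RintegralZl//; last first.
    exact: (@integrableB _ _ _ _ _ mS (EFin \o X) (EFin \o (fun=> k))).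
  by rewrite RintegralB// Rintegral_cst// mulrBr mulrA.
have E : \int[Q]_(w in S) (e * (w.1.2 - k)) = \int[Q]_(w in S) (e * (w.2 - k)).
  rewrite !affine; [|exact: Q3|exact: Q2].
  by rewrite /Rintegral M3_integral_eq.
have -> : \int[Q]_x (\1_A (proj12 x).1 * g (proj12 x).2) =
    \int[Q]_(w in S) (e * (w.1.2 - k)).
  rewrite [RHS]Rintegral_mkcond; apply: eq_Rintegral => w _.
  rewrite patchE memS indicE /proj12/= /g.
  case: (_ \in A); rewrite /= ?mul0r// mul1r.
  by case: ltP => // [/ltW/max_idPl|/max_idPr].
rewrite E Rintegral_mkcond; apply: le_Rintegral => //.
- have -> : EFin \o (fun w => e * (w.2 - k)) \_ S =
      (fun w => (e * (w.2 - k))%:E) \_ S.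
    by apply/funext => w; rewrite /= !patchE; case: ifPn.
  apply/(integrable_mkcond _ mS).
  have ci : Q.-integrable setT (EFin \o cst k) by exact:
    finite_measure_integrable_cst.
  have I := integrableZl measurableT e (integrableB measurableT (Q3 h3) ci).
  exact: integrableS measurableT mS (@subsetT _ S) I.
- move=> w _; rewrite patchE memS indicE /proj13/= /g.
  case: (_ \in A) => /=; last by rewrite mul0r.
  by rewrite mul1r; case: ifPn => _; rewrite le_max lexx ?orbT.
Qed.

End three_periods.

(** * Convergence of expectations *)

Section grid.
Context (R : realType).
Implicit Types (c : R * R -> R) (N e : R).

(** Around each point of the compact box the oscillation of [c] is controlled on a ball of radius r.
    Halving r leaves room for the second point, which may lie outside the box. *)
Lemma box_unif_continuous c N e : continuous c -> 0 < e ->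
  exists2 d : R, 0 < d & forall w w' : R * R, `|w.1| <= N -> `|w.2| <= N ->
    `|w'.1 - w.1| < d -> `|w'.2 - w.2| < d -> `|c w - c w'| <= e.
Proof.
move=> cc e0.
pose P (d : R) (w : R * R) := forall w' : R * R,
  `|w'.1 - w.1| < d -> `|w'.2 - w.2| < d -> `|c w - c w'| <= e.
have cK : compact (`[- N, N]%classic `*` `[- N, N]%classic : set (R * R)).
  by apply: compact_setX; exact: segment_compact.
have /compact_near_coveringP/(_ _ (0 : R)^'+ P _) H := cK.
have near_d : \forall d \near (0 : R)^'+,
    (`[- N, N]%classic `*` `[- N, N]%classic : set (R * R)) `<=` P d /\ 0 < d.
  apply: filterI; last exact: nbhs_right_gt.
  apply: H => -[x y] _.
  have e2 : 0 < e / 2 by rewrite divr_gt0.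
  have /cvgrPdist_lt/(_ _ e2)/nbhs_ballP[r /= r0 Hr] := cc (x, y).
  have r2 : 0 < r / 2 by rewrite divr_gt0.
  exists (ball ((x, y) : R * R) (r / 2), [set d | d < r / 2]).
    by split; [exact: nbhsx_ballx|exact: nbhs_right_lt].
  move=> [[x' y'] d] /= [[bx by_] dr] [x'' y''] /= hx hy.
  move: bx by_; rewrite /ball/= => bx by_.
  have h1 : `|c (x, y) - c (x', y')| < e / 2.
    by apply: Hr; split; rewrite /ball/=; lra.
  have h2 : `|c (x, y) - c (x'', y'')| < e / 2.
    apply: Hr; split; rewrite /ball/=.
    - have := ler_distD x' x x''; rewrite (distrC x' x''); lra.
    - have := ler_distD y' y y''; rewrite (distrC y' y''); lra.
  have := ler_distD (c (x, y)) (c (x', y')) (c (x'', y'')).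
  rewrite (distrC (c (x', y')) (c (x, y))); lra.
have [d] := @filter_ex _ _ (at_right_proper_filter (0 : R)) _ near_d.
move=> [Kd d0].
exists d => // w w' w1 w2; apply: Kd.
by split; rewrite /= in_itv/= -ler_norml.
Qed.

Let pt N (K : nat) (i : nat) : R := - N + i%:R * (2 * N / K%:R).

(** A cell indicator is the difference of the indicators of [x < t] at its two endpoints, so the sum
    telescopes. *)
Let sum_cells N K x : 0 <= N -> (0 < K)%N ->
  \sum_(i < K) \1_(`[pt N K i, pt N K i.+1[%classic) x =
  \1_(`[- N, N[%classic) x :> R.
Proof.
move=> N0 K0.
have d0 : 0 <= 2 * N / K%:R by rewrite divr_ge0// mulr_ge0.
have ptS i j : (i <= j)%N -> pt N K i <= pt N K j.
  by move=> ij; rewrite /pt lerD2l ler_wpM2r// ler_nat.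
have cellE (s t : R) : s <= t ->
    \1_(`[s, t[%classic) x = (x < t)%R%:R - (x < s)%R%:R :> R.
  move=> st; rewrite indicE (_ : (x \in _) = (s <= x < t)); last first.
    by apply/idP/idP => [/set_mem/=|H]; [rewrite in_itv|apply/mem_set;
      rewrite /= in_itv].
  by case: (ltP x s) => xs; rewrite ?(lt_le_trans xs st) /= ?subrr ?subr0.
transitivity (\sum_(0 <= i < K) ((x < pt N K i.+1)%R%:R - (x < pt N K i)%R%:R :
  R)).
  by rewrite big_mkord; apply: eq_bigr => i _; rewrite cellE// ptS.
rewrite telescope_sumr// cellE; last by lra.
rewrite /pt mul0r addr0 mulrCA divff ?pnatr_eq0 -?lt0n// mulr1.
by rewrite (_ : - N + 2 * N = N)//; ring.
Qed.

(** Half-open cells are used because limits are known on sets A x []-oo, t[], whose differences they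
    are. The cells partition the box, so the error inside is that of a single cell; outside the box
    both terms vanish. *)
Lemma step_approx c N e : continuous c -> 0 < N -> 0 < e ->
  exists (I : finType) (a : I -> R) (s t : I -> R * R),
    (forall i, (s i).1 <= (t i).1) /\ (forall i, (s i).2 <= (t i).2) /\
    forall w, `|c w * (\1_(`[- N, N[%classic) w.1 * \1_(`[- N, N[%classic) w.2) -
      \sum_i a i * (\1_(`[(s i).1, (t i).1[%classic) w.1 *
                    \1_(`[(s i).2, (t i).2[%classic) w.2)| <= e.
Proof.
move=> cc N0 e0; have [d d0 Hd] := box_unif_continuous N cc e0.
(* The cells have side [2 * N / K] smaller than [d], so [c] varies by at most [e] between a point
   and the lower corner of its cell. *)
pose K := (Num.truncn (2 * N / d)).+1.
have K0 : (0 < K)%N by [].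
have KR : 0 < K%:R :> R by rewrite ltr0n.
have dK : 2 * N / K%:R < d.
  rewrite ltr_pdivrMr// [d * _]mulrC -ltr_pdivrMr//; exact: truncnS_gt.
have d0' : 0 <= 2 * N / K%:R by rewrite divr_ge0// ?mulr_ge0// ltW.
have ptS i j : (i <= j)%N -> pt N K i <= pt N K j.
  by move=> ij; rewrite /pt lerD2l ler_wpM2r// ler_nat.
exists ('I_K * 'I_K)%type, (fun k : 'I_K * 'I_K => c (pt N K k.1, pt N K k.2)),
  (fun k : 'I_K * 'I_K => (pt N K k.1, pt N K k.2)),
    (fun k : 'I_K * 'I_K => (pt N K k.1.+1, pt N K k.2.+1)).
split; first by move=> i; exact: ptS.
split; first by move=> i; exact: ptS.
move=> w.
have boxE : \1_(`[- N, N[%classic) w.1 * \1_(`[- N, N[%classic) w.2 =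
    \sum_(k : 'I_K * 'I_K) \1_(`[pt N K k.1, pt N K k.1.+1[%classic) w.1 *
      \1_(`[pt N K k.2, pt N K k.2.+1[%classic) w.2 :> R.
  rewrite -(@sum_cells N K w.1)// ?(ltW N0)// -(@sum_cells N K w.2)// ?(ltW N0)//.
  by rewrite big_distrlr/= pair_big.
have box1 : \1_(`[- N, N[%classic) w.1 * \1_(`[- N, N[%classic) w.2 <= 1 :> R.
  by rewrite !indicE -natrM mulnb; case: (_ && _).
have box0 : 0 <= \1_(`[- N, N[%classic) w.1 * \1_(`[- N, N[%classic) w.2 :> R.
  by rewrite mulr_ge0.
case: (ltP 0 (\1_(`[- N, N[%classic) w.1 * \1_(`[- N, N[%classic) w.2 : R));
  last first.
  move=> b0; have {}b0 : \1_(`[- N, N[%classic) w.1 * \1_(`[- N,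
    N[%classic) w.2 = 0 :> R.
    by apply/eqP; rewrite eq_le b0.
  rewrite b0 mulr0 sub0r normrN big1 ?normr0 ?ltW// => k _.
  have /eqP := b0; rewrite boxE psumr_eq0; last by move=> i _; rewrite mulr_ge0.
  by move=> /allP/(_ k (mem_index_enum k))/eqP ->; rewrite mulr0.
move=> b0.
have wN : `|w.1| <= N /\ `|w.2| <= N.
  move: b0; rewrite !indicE -natrM mulnb ltr0n lt0b => /andP[/set_mem/= +
    /set_mem/=].
  rewrite !in_itv/= => /andP[a1 a2] /andP[a3 a4].
  by rewrite !ler_norml a1 a3 !ltW.
rewrite boxE big_distrr/= -sumrB.
apply: (@le_trans _ _ (\sum_(k : 'I_K * 'I_K) e * (\1_(`[pt N K k.1,
  pt N K k.1.+1[%classic) w.1 *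
      \1_(`[pt N K k.2, pt N K k.2.+1[%classic) w.2))); last first.
  by rewrite -big_distrr/= -boxE ler_piMr// ltW.
apply: le_trans (ler_norm_sum _ _ _) _; apply: ler_sum => k _.
rewrite -mulrBl normrM [X in _ * X]ger0_norm ?mulr_ge0//.
have [c0|c0] := ltP 0 (\1_(`[pt N K k.1, pt N K k.1.+1[%classic) w.1 *
      \1_(`[pt N K k.2, pt N K k.2.+1[%classic) w.2 : R); last first.
  rewrite (_ : _ * \1__ _ = 0) ?mulr0//.
  by apply/eqP; rewrite eq_le c0 mulr_ge0.
rewrite ler_pM2r//.
move: c0; rewrite !indicE -natrM mulnb ltr0n lt0b => /andP[/set_mem/= +
  /set_mem/=].
rewrite !in_itv/= => /andP[a1 a2] /andP[a3 a4].
have stepE i : pt N K i.+1 = pt N K i + 2 * N / K%:R by rewrite /pt -natr1; ring.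
rewrite !stepE in a2 a4.
by apply: Hd => //=; rewrite ?wN.1 ?wN.2// ltr_norml; apply/andP; split; lra.
Qed.

(** Measurability refers to the product sigma-algebra: [c] is the pointwise limit of step functions
    on rectangles, with boxes of half-width n + 1 and error at most 1 / (n + 1). *)
Lemma continuous2_measurable c : continuous c -> measurable_fun setT c.
Proof.
move=> cc.
have H (n : nat) : exists g : R * R -> R, measurable_fun setT g /\
    forall w, `|c w * (\1_(`[- n.+1%:R, n.+1%:R[%classic) w.1 *
      \1_(`[- n.+1%:R, n.+1%:R[%classic) w.2) - g w| <= n.+1%:R^-1.
  have [//||I [a [s [t [_ [_ g]]]]]] := @step_approx c n.+1%:R n.+1%:R^-1 cc.
    by rewrite invr_gt0.
  exists (fun w => \sum_i a i * (\1_(`[(s i).1, (t i).1[%classic) w.1 *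
                    \1_(`[(s i).2, (t i).2[%classic) w.2)); split => //.
  apply: measurable_sum => i.
  apply: measurable_funM => //; apply: measurable_funM.
    by apply: measurableT_comp => //; exact: measurable_indic.
  by apply: measurableT_comp => //; exact: measurable_indic.
have [g Hg] := choice H.
apply: (measurable_fun_cvg (h := g)); first by move=> n; have [] := Hg n.
move=> w _; apply/cvgrPdist_le => e e0.
near=> n.
have [_ /(_ w)] := Hg n.
have box (z : R) : `|z| < n.+1%:R -> \1_(`[- n.+1%:R,
  n.+1%:R[%classic) z = 1 :> R.
  rewrite ltr_norml => /andP[z1 z2]; rewrite indicE mem_set//= in_itv/= z2 andbT.
  exact: ltW.
rewrite !box ?mulr1//.
  move=> /le_trans; apply; apply: ltW; near: n;
    exact: (near_infty_natSinv_lt (PosNum e0)).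
all: apply: (@lt_trans _ _ n%:R); rewrite ?ltr_nat//; near: n;
  exact: nbhs_infty_gtr.
Unshelve. all: by end_near. Qed.

End grid.

(** Dominated convergence, with |x| as the dominating function. Only a marginal enters, so the
    threshold serves all couplings at once. *)
Lemma tail_expectation_small (R : realType) (mu : probability R R) (e : R) :
  finite_first_moment mu -> 0 < e -> exists N : nat, forall n : nat, (N <= n)%N ->
  \int[mu]_x (\1_[set x | n%:R <= `|x|] x * `|x|) <= e.
Proof.
move=> hmu e0.
pose f (n : nat) (x : R) := (\1_[set x | n%:R <= `|x|] x * `|x|)%:E.
have mA (n : nat) : measurable [set x : R | n%:R <= `|x|].
  rewrite -[X in measurable X]setTI.
  apply: (measurable_fun_ler _ _ measurableT (Y := [set true])) => //.
have mf n : measurable_fun setT (f n).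
  apply/measurable_EFinP; apply: measurable_funM; last exact: normr_measurable.
  exact: measurable_indic.
have f0 : {ae mu, forall x, setT x -> f ^~ x @ \oo --> 0%E}.
  apply: aeW => x _; apply: cvg_near_cst; near=> n.
  rewrite /f indicE memNset ?mul0r//= => xn.
  have : `|x| < n%:R by near: n; exact: nbhs_infty_gtr.
  by rewrite ltNge xn.
have fg : {ae mu, forall x n, setT x -> (`|f n x| <= `|x|%:E)%E}.
  apply: aeW => x n _; rewrite lee_fin normrM normr_id indicE.
  by case: (_ \in _); rewrite ?normr1 ?normr0 ?mul1r ?mul0r.
have [_ _] := @dominated_convergence _ _ _ mu setT measurableT f (cst 0%E)
  (fun x => `|x|%:E) mf (measurable_cst _) f0 (integrable_norm hmu) fg.
rewrite integral0_eq// => /fine_cvg/cvgrPdist_lt/(_ _ e0)[N _ HN].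
exists N => n /HN /=; rewrite sub0r normrN => /ltW; apply: le_trans.
exact: ler_norm.
Unshelve. all: by end_near. Qed.

Lemma Rintegral_sum d (T : measurableType d) (R : realType) (m : {measure set T
  -> \bar R})
    (I : Type) (s : seq I) (a : I -> R) (f : I -> T -> R) :
  (forall i, m.-integrable setT (EFin \o f i)) ->
  m.-integrable setT (EFin \o (fun x => \sum_(i <- s) a i * f i x)) /\
  \int[m]_x (\sum_(i <- s) a i * f i x) = \sum_(i <- s) a i * \int[m]_x f i x.
Proof.
move=> fi; elim: s => [|i s [ihi ihE]].
  split; last by under eq_Rintegral do rewrite big_nil;
    rewrite Rintegral_cst// mul0r big_nil.
  rewrite (_ : _ \o _ = cst 0%E); first exact: integrable0.
  by apply/funext => x /=; rewrite big_nil.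
have ai : m.-integrable setT (EFin \o (fun x => a i * f i x)).
  exact: (integrableZl measurableT (a i) (fi i)).
have E : (fun x => \sum_(i <- i :: s) a i * f i x) =
    (fun x => a i * f i x + \sum_(i <- s) a i * f i x).
  by apply/funext => x; rewrite big_cons.
rewrite E; split; first exact: (integrableD measurableT ai ihi).
by rewrite RintegralD// RintegralZl// ihE big_cons.
Qed.

Lemma Rintegral_indic d (T : measurableType d) (R : realType)
    (m : {measure set T -> \bar R}) (A : set T) : measurable A ->
  \int[m]_x \1_A x = fine (m A).
Proof. by move=> mA; rewrite /Rintegral integral_indic// setIT. Qed.

(** * Test functions of linear growth *)

Section C_lin2.
Context (R : realType) (mu nu : probability R R).
Hypotheses (hmu : finite_first_moment mu) (hnu : finite_first_moment nu).
Variable c : R * R -> R.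
Hypothesis hc : C_lin2 c.

Lemma C_lin2_bound : exists2 C, 0 <= C & forall w,
  `|c w| <= C * (1 + (`|w.1| + `|w.2|)).
Proof.
have [_ [C HC]] := hc; exists (Num.max C 0); first by rewrite le_max lexx orbT.
move=> w; have p0 : 0 < 1 + (`|w.1| + `|w.2|) by rewrite ltr_wpDr// addr_ge0.
rewrite -ler_pdivrMr// le_max; apply/orP; left.
by apply: HC; exists w.
Qed.

Lemma C_lin2_integrable (m : probability (R * R)%type R) : coupling mu nu m ->
  m.-integrable setT (EFin \o c).
Proof.
move=> hm; have [C C0 HC] := C_lin2_bound.
apply: (le_integrableR _ HC); first exact: continuous2_measurable hc.1.
have i1 := coupling_integrable1 hm (integrable_norm hmu).
have i2 := coupling_integrable2 hm (integrable_norm hnu).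
have ci : m.-integrable setT (EFin \o cst 1) by exact:
  finite_measure_integrable_cst.
exact: (integrableZl measurableT C (integrableD measurableT ci (integrableD
  measurableT i1 i2))).
Qed.

End C_lin2.

Section limit.
Context (R : realType) (mu nu : probability R R).
Hypotheses (hmu : finite_first_moment mu) (hnu : finite_first_moment nu).
Context (U : set_system nat) {UU : UltraFilter U}.
Variables (Q : nat -> probability (R * R)%type R) (P : probability (R * R)%type
  R).
Hypotheses (hQ : forall n, coupling mu nu (Q n)) (hP : coupling mu nu P).
Hypothesis QP : forall (A : set R) t, measurable A ->
  (fun n => fine (Q n (A `*` `]-oo, t[))) @ U --> fine (P (A `*` `]-oo, t[)).

Let good (f : R * R -> R) :=
  (fun n => \int[Q n]_w f w) @ U --> \int[P]_w f w.

Let good_cell (B : set R) s t : measurable B -> s <= t ->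
  good (fun w => \1_B w.1 * \1_(`[s, t[%classic) w.2).
Proof.
move=> mB st.
have E (m : probability (R * R)%type R) : \int[m]_w (\1_B w.1 * \1_(`[s,
  t[%classic) w.2) =
    fine (m (B `*` `]-oo, t[)) - fine (m (B `*` `]-oo, s[)).
  have mX r : measurable (B `*` `]-oo, r[ : set (R * R)) by exact: measurableX.
  have mst : measurable (B `*` `[s, t[%classic : set (R * R)) by exact:
    measurableX.
  have -> : (fun w : R * R => \1_B w.1 * \1_(`[s,
    t[%classic) w.2 : R) = \1_(B `*` `[s, t[%classic).
    by apply/funext => w; rewrite !indicE in_setX -natrM mulnb.
  rewrite Rintegral_indic//.
  have -> : B `*` `]-oo, t[ = (B `*` `]-oo, s[) `|` (B `*` `[s, t[%classic).
    apply/seteqP; split => -[x y] /=; rewrite !in_itv/=.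
      by move=> [Bx yt]; have [ys|ys] := ltP y s; [left|right].
    by move=> [[Bx ys]|[Bx /andP[_ yt]]]; split => //; exact: lt_le_trans ys st.
  rewrite measureU//; last first.
    apply/seteqP; split => -[x y] //= [[_]]; rewrite !in_itv/= => ys [_ /andP[]].
    by rewrite leNgt ys.
  by rewrite fineD ?fin_num_measure// addrC addKr.
rewrite /good E; under eq_fun do rewrite E.
by apply: cvgB; exact: QP.
Qed.

Let good_sum (I : Type) (s : seq I) (a : I -> R) (f : I -> R * R -> R) :
  (forall i, good (f i)) -> (forall i, measurable_fun setT (f i)) ->
  (forall i w, `|f i w| <= 1) -> good (fun w => \sum_(i <- s) a i * f i w).
Proof.
move=> gf mf f1.
have fi (m : probability (R * R)%type R) i : m.-integrable setT (EFin \o f i).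
  apply: (le_integrableR (mf i) (f1 i)); exact: finite_measure_integrable_cst.
rewrite /good (Rintegral_sum s a (fi P)).2.
under eq_fun => n do rewrite (Rintegral_sum s a (fi (Q n))).2.
elim: s => [|i s ih].
  rewrite big_nil; under eq_fun do rewrite big_nil; exact: cvg_cst.
rewrite big_cons.
have -> : (fun n => \sum_(j <- i :: s) a j * \int[Q n]_w f j w) =
    (fun n => a i * \int[Q n]_w f i w + \sum_(j <- s) a j * \int[Q n]_w f j w).
  by apply/funext => n; rewrite big_cons.
by apply: cvgD => //; apply: cvgMr; exact: gf.
Qed.

(** Three-epsilon argument: the approximation error is uniform over all couplings of [mu] and [nu],
    so [g] is fixed before n varies. *)
Let good_approx (f : R * R -> R) :
  (forall m, coupling mu nu m -> m.-integrable setT (EFin \o f)) ->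
  (forall e : R, 0 < e -> exists g, [/\ good g,
     forall m, coupling mu nu m -> m.-integrable setT (EFin \o g) &
     forall m, coupling mu nu m -> \int[m]_w `|f w - g w| <= e]) ->
  good f.
Proof.
move=> fi H; apply/cvgrPdist_le => e e0.
have e3 : 0 < e / 3 by rewrite divr_gt0.
have [g [gg gi fg]] := H _ e3.
have D (m : probability (R * R)%type R) : coupling mu nu m ->
    `|\int[m]_w f w - \int[m]_w g w| <= e / 3.
  move=> hm; rewrite -RintegralB//; [|exact: fi|exact: gi].
  apply: le_trans (fg _ hm); apply: le_normr_Rintegral => //.
  exact: (integrableB measurableT (fi _ hm) (gi _ hm)).
have /cvgrPdist_le/(_ _ e3) := gg.
apply: filterS => n Hn.
have := D _ hP; have := D _ (hQ n); move: Hn; rewrite !ler_norml.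
move=> /andP[? ?] /andP[? ?] /andP[? ?]; apply/andP; split; lra.
Qed.

(** Inside a large box the integrand is uniformly close to a step function over cells whose first
    side is intersected with [A]. Outside, linear growth bounds it by the tails of the two
    marginals, uniformly over couplings. *)
Lemma coupling_cvg (A : set R) (c : R * R -> R) : measurable A -> C_lin2 c ->
  (fun n => \int[Q n]_w (\1_A w.1 * c w)) @ U --> \int[P]_w (\1_A w.1 * c w).
Proof.
move=> mA hc; have [C C0 HC] := C_lin2_bound hc.
have mA1 : measurable (fst @^-1` A : set (R * R)).
  by rewrite -[_ @^-1` _]setTI; exact: measurable_fst.
have fi (m : probability (R * R)%type R) : coupling mu nu m ->
    m.-integrable setT (EFin \o (fun w => \1_A w.1 * c w)).
  by move=> hm; exact: (integrable_indicM mA1 (C_lin2_integrable hmu hnu hc hm)).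
apply: good_approx => // e e0.
(* Half of [e] is spent inside the box. Outside, each of the two marginal tails is multiplied by
   [3 * C] and costs at most [e / 4]; the added 1 keeps the denominator positive when C = 0. *)
have C3 : 0 < 3 * C + 1 by lra.
have e4 : 0 < e / 4 / (3 * C + 1) by rewrite !divr_gt0.
have [N1 HN1] := tail_expectation_small hmu e4.
have [N2 HN2] := tail_expectation_small hnu e4.
pose n := (N1 + N2).+1; pose N : R := n%:R.
have N0 : 0 < N by rewrite ltr0n.
have e2 : 0 < e / 2 by rewrite divr_gt0.
have [I [a [s [t [st1 [st2 step]]]]]] := step_approx hc.1 N0 e2.
pose B i := A `&` `[(s i).1, (t i).1[%classic.
have mB i : measurable (B i) by exact: measurableI.
pose h i (w : R * R) : R := \1_(B i) w.1 * \1_(`[(s i).2, (t i).2[%classic) w.2.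
have mh i : measurable_fun setT (h i).
  apply: measurable_funM.
    by apply: measurableT_comp => //; exact: measurable_indic.
  by apply: measurableT_comp => //; exact: measurable_indic.
have h1 i w : `|h i w| <= 1.
  by rewrite /h !indicE -natrM mulnb; case: (_ && _); rewrite ?normr1 ?normr0.
have hi (m : probability (R * R)%type R) i : m.-integrable setT (EFin \o h i).
  apply: (le_integrableR (mh i) (h1 i)); exact: finite_measure_integrable_cst.
exists (fun w => \sum_i a i * h i w); split.
- by apply: good_sum => // i; apply: good_cell.
- by move=> m hm; exact: (Rintegral_sum _ a (hi m)).1.
move=> m hm.
pose tl (x : R) : R := \1_[set x | n%:R <= `|x|] x * `|x|.
have tl0 x : 0 <= tl x by rewrite mulr_ge0.
have mT : measurable [set x : R | n%:R <= `|x|].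
  rewrite -[X in measurable X]setTI.
  by apply: (measurable_fun_ler _ _ measurableT (Y := [set true])).
have tli (k : probability R R) : finite_first_moment k -> k.-integrable setT
  (EFin \o tl).
  by move=> hk; apply: integrable_indicM => //; exact: integrable_norm hk.
have tl1 := coupling_integrable1 hm (tli _ hmu).
have tl2 := coupling_integrable2 hm (tli _ hnu).
have ci : m.-integrable setT (EFin \o cst (e / 2)) by exact:
  finite_measure_integrable_cst.
have ti := integrableZl measurableT (3 * C) (integrableD measurableT tl1 tl2).
have bound w : `|\1_A w.1 * c w - \sum_i a i * h i w| <= e / 2 + 3 * C * (tl w.1
  + tl w.2).
  have tlE x : n%:R <= `|x| -> tl x = `|x|.
    by move=> nx; rewrite /tl indicE mem_set// mul1r.
  have out x : \1_(`[- N, N[%classic) x = 0 :> R -> N <= `|x|.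
    rewrite indicE; case: (boolP (_ \in _)) => [_ /eqP|];
      first by rewrite oner_eq0.
    rewrite notin_setE/= in_itv/= => H _; rewrite leNgt; apply/negP => xN.
    by apply: H; move: xN; rewrite ltr_norml => /andP[/ltW -> ->].
  have N1' : 1 <= N by rewrite ler1n.
  (* Since 1 <= N <= |x|, each of 1, |x| and, when below N, |y| is at most |x|, whence the factor 3.
     This is why [n] is a successor. *)
  have tl_out x y : N <= `|x| -> 1 + (`|x| + `|y|) <= 3 * (tl x + tl y).
    move=> Nx; rewrite (tlE x Nx); have y0 := normr_ge0 y.
    have [yN|Ny] := ltP `|y| N; last by rewrite (tlE y Ny); lra.
    have := tl0 y; lra.
  have A0 : (0 : R) <= \1_A w.1 by [].
  have A1 : \1_A w.1 <= (1 : R) by rewrite indicE; case: (_ \in _).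
  pose box : R := \1_(`[- N, N[%classic) w.1 * \1_(`[- N, N[%classic) w.2.
  pose g : R := \sum_i a i * (\1_(`[(s i).1, (t i).1[%classic) w.1 *
                    \1_(`[(s i).2, (t i).2[%classic) w.2).
  have -> : \1_A w.1 * c w - \sum_i a i * h i w =
      \1_A w.1 * (c w * box - g) + \1_A w.1 * (c w * (1 - box)).
    rewrite (_ : \sum_i a i * h i w = \1_A w.1 * g); first ring.
    rewrite /g big_distrr/=; apply: eq_bigr => i _.
    rewrite /h /B indicI/=; ring.
  apply: le_trans (ler_normD _ _) _; apply: lerD.
    rewrite normrM (ger0_norm A0); apply: le_trans (step w).
    by rewrite ler_piMl.
  rewrite normrM (ger0_norm A0); apply: (@le_trans _ _ `|c w * (1 - box)|).
    by rewrite ler_piMl.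
  have bound0 : `|c w| <= 3 * C * (tl w.1 + tl w.2) \/ box = 1.
    case: (eqVneq (\1_(`[- N, N[%classic) w.1 : R) 0) => [/out w1|w1].
      left; apply: le_trans (HC w) _; rewrite -mulrA mulrCA ler_wpM2l//.
      exact: tl_out.
    case: (eqVneq (\1_(`[- N, N[%classic) w.2 : R) 0) => [/out w2|w2].
      left; apply: le_trans (HC w) _; rewrite -mulrA mulrCA ler_wpM2l//.
      by rewrite [`|w.1| + _]addrC [tl w.1 + _]addrC; exact: tl_out.
    right; move: w1 w2; rewrite /box !indicE.
    by case: (_ \in _); case: (_ \in _); rewrite ?eqxx ?mulr1.
  have [H|->] := bound0; last by rewrite subrr mulr0 normr0 !mulr_ge0// addr_ge0.
  apply: le_trans H; rewrite normrM ler_piMr//.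
  rewrite /box !indicE -natrM mulnb; case: (_ && _);
    rewrite /= ?subrr ?subr0 ?normr0 ?normr1 ?ler01 ?lexx //.
apply: (@le_trans _ _ (\int[m]_w (e / 2 + 3 * C * (tl w.1 + tl w.2)))).
  apply: le_Rintegral => //.
  - apply: integrable_norm.
    exact: (integrableB measurableT (fi _ hm) (Rintegral_sum _ a (hi m)).1).
  - exact: (integrableD measurableT ci ti).
rewrite (RintegralD measurableT ci ti) Rintegral_cst// [X in fine (X _)]/=
  probability_setT mulr1.
rewrite RintegralZl//; last exact: (integrableD measurableT tl1 tl2).
rewrite (RintegralD measurableT tl1 tl2).
have -> : \int[m]_w tl w.1 = \int[mu]_x tl x.
  by rewrite /Rintegral (has_law_integral measurable_fst hm.1 (tli _ hmu)).
have -> : \int[m]_w tl w.2 = \int[nu]_x tl x.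
  by rewrite /Rintegral (has_law_integral measurable_snd hm.2 (tli _ hnu)).
have t1 : \int[mu]_x tl x <= e / 4 / (3 * C + 1) by apply: HN1;
  rewrite leqW// leq_addr.
have t2 : \int[nu]_x tl x <= e / 4 / (3 * C + 1) by apply: HN2;
  rewrite leqW// leq_addl.
have t3 : 3 * C * (e / 4 / (3 * C + 1)) <= e / 4.
  rewrite mulrA ler_pdivrMr//; nra.
have : 3 * C * (\int[mu]_x tl x + \int[nu]_x tl x) <=
    3 * C * (e / 4 / (3 * C + 1) + e / 4 / (3 * C + 1)).
  by rewrite ler_wpM2l ?mulr_ge0// lerD.
lra.
Qed.

End limit.

(** * Ultralimits of two-period martingale laws *)

Section compactness.
Context (R : realType) (mu nu : probability R R).
Hypotheses (hmu : finite_first_moment mu) (hnu : finite_first_moment nu).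

Lemma C_lin2_fst : C_lin2 (fun w : R * R => w.1).
Proof.
split; first by move=> w; exact: cvg_fst.
exists 1 => _ [w _ <-]; have y0 := normr_ge0 w.2; have x0 := normr_ge0 w.1.
by rewrite ler_pdivrMr ?mul1r; lra.
Qed.

Lemma C_lin2_snd : C_lin2 (fun w : R * R => w.2).
Proof.
split; first by move=> w; exact: cvg_snd.
exists 1 => _ [w _ <-]; have y0 := normr_ge0 w.2; have x0 := normr_ge0 w.1.
by rewrite ler_pdivrMr ?mul1r; lra.
Qed.

Lemma C_lin2_hinge (e k : R) : C_lin2 (fun w : R * R => Num.max (e * (w.2 - k))
  0).
Proof.
split.
  move=> w; apply: (@continuous_max _ _ (fun w : R * R => e * (w.2 - k)) (cst
    0)); last exact: cvg_cst.
  by apply: cvgMr; apply: cvgB; [exact: cvg_snd|exact: cvg_cst].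
exists (`|e| * (1 + `|k|)) => _ [w _ <-].
have y0 := normr_ge0 w.2; have x0 := normr_ge0 w.1; have k0 := normr_ge0 k.
rewrite ler_pdivrMr; last lra.
apply: (@le_trans _ _ (`|e| * (`|w.2| + `|k|))).
  apply: (@le_trans _ _ `|e * (w.2 - k)|).
    by case: (leP (e * (w.2 - k)) 0) => _; rewrite ?normr0.
  by rewrite normrM ler_wpM2l// ler_normB.
rewrite -mulrA ler_wpM2l//; nra.
Qed.

Let restrictE (m : probability (R * R)%type R) (A : set R) (f : R * R -> R) :
  \int[m]_(w in fst @^-1` A) f w = \int[m]_w (\1_A w.1 * f w).
Proof. exact: Rintegral_indicM. Qed.

(* Weak compactness of M2, in the form of convergence along ultrafilters. *)
Lemma M2_ultralimit (U : set_system nat) {UU : UltraFilter U}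
    (Q : nat -> probability (R * R)%type R) : (forall n, M2 mu nu (Q n)) ->
  exists2 P, M2 mu nu P & forall A c, measurable A -> C_lin2 c ->
    (fun n => \int[Q n]_w (\1_A w.1 * c w)) @ U --> \int[P]_w (\1_A w.1 * c w).
Proof.
move=> hQ.
have cQ n : coupling mu nu (Q n) by have [] := (M2P hmu hnu (Q n)).1 (hQ n).
have pre1 (A : set R) : fst @^-1` A = A `*` setT :> set (R * R).
  by apply/seteqP; split => -[x y] //= [].
have pre2 (A : set R) : snd @^-1` A = setT `*` A :> set (R * R).
  by apply/seteqP; split => -[x y] //= [].
have [||P [P1 P2 PQ]] := @coupling_ultralimit _ R R U UU mu nu Q.
- by move=> n A mA; rewrite -pre1; exact: (cQ n).1.
- by move=> n A mA; rewrite -pre2; exact: (cQ n).2.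
have cP : coupling mu nu P.
  by split => A mA; rewrite /pushforward ?pre1 ?pre2; [exact: P1|exact: P2].
have lim := @coupling_cvg R mu nu hmu hnu U UU Q P cQ cP PQ.
exists P; last exact: lim.
apply/M2P => //; split => // A mA.
have mA1 : measurable (fst @^-1` A : set (R * R)).
  by rewrite -[_ @^-1` _]setTI; exact: measurable_fst.
have fstfin (m : probability (R * R)%type R) : coupling mu nu m ->
    (\int[m]_(w in fst @^-1` A) w.1%:E)%E \is a fin_num.
  move=> hm; apply: integrable_fin_num => //.
  exact: integrableS measurableT mA1 (@subsetT _ _) (@coupling_integrable1 _ _ _
    _ id hm hmu).
have sndfin (m : probability (R * R)%type R) : coupling mu nu m ->
    (\int[m]_(w in fst @^-1` A) w.2%:E)%E \is a fin_num.
  move=> hm; apply: integrable_fin_num => //.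
  exact: integrableS measurableT mA1 (@subsetT _ _) (@coupling_integrable2 _ _ _
    _ id hm hnu).
rewrite -[LHS]fineK ?fstfin// -[RHS]fineK ?sndfin//; congr EFin.
rewrite -[LHS]/(\int[P]_(w in fst @^-1` A) w.1) -[RHS]/(\int[P]_(w in fst @^-1`
  A) w.2).
rewrite !restrictE.
(* Both coordinates have linear growth, and their integrals over the event that the first one lies
   in [A] agree for each n, so the limits agree too. *)
have l1 := lim _ _ mA C_lin2_fst; have l2 := lim _ _ mA C_lin2_snd.
apply: (cvg_unique (@Rhausdorff R) l1).
rewrite (_ : (fun n => _) = (fun n => \int[Q n]_w (\1_A w.1 * w.2)))//.
apply/funext => n; rewrite -!restrictE /Rintegral.
by rewrite ((M2P hmu hnu (Q n)).1 (hQ n)).2.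
Qed.

End compactness.

(** * The binomial extension of a two-period law *)

Lemma unif_two_values (R : realType) (p a b : R) : 0 <= p <= 1 ->
  (\int[unif]_u (if u < p then a else b)%:E = (a * p + b * (1 - p))%:E)%E.
Proof.
move=> p01.
have mp : measurable (`]-oo, p[%classic : set R) by [].
have bi : (@unif R).-integrable setT (EFin \o cst b) by exact:
  finite_measure_integrable_cst.
have ii := integrableZl measurableT (a - b) (integrable_indic (@unif R) mp).
rewrite (eq_integral (fun u => b%:E + (a - b)%:E * (\1_(`]-oo,
  p[%classic) u)%:E)%E); last first.
  move=> u _; rewrite -EFinM -EFinD indicE.
  rewrite (_ : (u \in _) = (u < p)); last first.
    by apply/idP/idP => [/set_mem/=|H]; [rewrite in_itv|apply/mem_set;
      rewrite /= in_itv].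
  by case: ifPn => _; congr (_%:E); rewrite /=; ring.
rewrite integralD// integralZl//; last exact: integrable_indic.
rewrite integral_cst// [X in (b%:E * X)%E](_ : _ = 1%E);
  last exact: probability_setT.
rewrite mule1 integral_indic// setIT.
rewrite [X in (_ + _ * X)%E](unifE p01) -EFinM -EFinD; congr (_%:E); ring.
Qed.

Lemma Rintegral_eq_full d (T : measurableType d) (R : realType)
    (m : probability T R) (E : set T) (f g : T -> R) : measurable E -> m E = 1%E
      ->
  measurable_fun setT f -> measurable_fun setT g -> (forall x,
    E x -> f x = g x) ->
  \int[m]_x f x = \int[m]_x g x.
Proof.
move=> mE E1 mf mg fg; rewrite /Rintegral; congr fine.
apply: ae_eq_integral => //; [exact/measurable_EFinP|exact/measurable_EFinP|].
exists (~` E); split.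
- exact: measurableC.
- by have := @probability_setC _ _ _ m _ mE; rewrite E1 subee// => H; exact: H.
- by move=> x /= H Ex; apply: H => _; rewrite fg.
Qed.

Lemma integral_Rintegral_eq d d' (T : measurableType d) (T' : measurableType d')
    (R : realType) (m : {measure set T -> \bar R}) (m' : {measure set T' -> \bar
      R})
    (A : set T) (A' : set T') (f : T -> R) (g : T' -> R) :
  measurable A -> measurable A' ->
  m.-integrable setT (EFin \o f) -> m'.-integrable setT (EFin \o g) ->
  \int[m]_(x in A) f x = \int[m']_(x in A') g x ->
  (\int[m]_(x in A) (f x)%:E = \int[m']_(x in A') (g x)%:E)%E.
Proof.
move=> mA mA' fi gi fg.
have ff : (\int[m]_(x in A) (f x)%:E)%E \is a fin_num.
  exact: (integrable_fin_num mA (integrableS measurableT mA (@subsetT _ _) fi)).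
have gf : (\int[m']_(x in A') (g x)%:E)%E \is a fin_num.
  exact: (integrable_fin_num mA' (integrableS measurableT mA' (@subsetT _ _) gi)).
by rewrite -(fineK ff) -(fineK gf); congr EFin.
Qed.

(** * Two-valued kernels through an independent uniform variable *)

Section randomization.
Context d (T : measurableType d) (R : realType) (m : probability T R).

(** With an independent uniform u adjoined, a choice made with conditional probability p(x) is the
    event u < p(x), so kernels are handled as images of a product measure and Fubini applies. *)
Definition randomized : probability (T * R)%type R := (m \x unif)%E.

Lemma randomizedX (A : set T) (B : set R) : measurable A -> measurable B ->
  randomized (A `*` B) = (m A * unif B)%E.
Proof. by move=> mA mB; exact: product_measure1E. Qed.

Lemma integrable_randomized (g : T -> R) : m.-integrable setT (EFin \o g) ->
  randomized.-integrable setT (fun z => (g z.1)%:E).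
Proof.
move=> gi; apply/(integrable_law randomized measurable_fst (measurable_int _ gi)).
apply: eq_measure_integrable gi => A mA.
transitivity (randomized (A `*` setT)).
  by rewrite randomizedX// probability_setT mule1.
by congr (randomized _); apply/seteqP; split => -[x y] //= [].
Qed.

Lemma Rintegral_randomized (p a b : T -> R) :
  (forall x, 0 <= p x <= 1) ->
  randomized.-integrable setT (fun z => (if z.2 < p z.1 then a z.1 else b
    z.1)%:E) ->
  \int[randomized]_z (if z.2 < p z.1 then a z.1 else b z.1) =
  \int[m]_x (a x * p x + b x * (1 - p x)).
Proof.
move=> p01 fi; rewrite /Rintegral; congr fine.
have := integral12_prod_meas1 fi; rewrite -[X in _ = X -> _]/(integral
  randomized _ _) => <-.
by apply: eq_integral => x _; exact: (unif_two_values (a x) (b x) (p01 x)).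
Qed.

End randomization.

Section pullout.
Context (R : realType) (mu nu : probability R R).
Hypotheses (hmu : finite_first_moment mu) (hnu : finite_first_moment nu).
Variables (Q : probability (R * R)%type R) (hQ : M2 mu nu Q).

(* Writing psi(x) as the probability that a uniform variable is below psi(x)
   reduces the claim, by Fubini, to the case of indicators. *)
Lemma M2_pullout (psi : R -> R) : measurable_fun setT psi ->
  (forall x, 0 <= psi x <= 1) ->
  \int[Q]_w (w.2 * psi w.1) = \int[Q]_w (w.1 * psi w.1).
Proof.
move=> mpsi psi01; have [cQ QE] := (M2P hmu hnu Q).1 hQ.
have mA u : measurable [set x | u < psi x].
  rewrite -[X in measurable X]setTI.
  exact: (measurable_fun_ltr _ mpsi measurableT (Y := [set true])).
have mA1 u : measurable (fst @^-1` [set x | u < psi x] : set (R * R)).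
  by rewrite -[_ @^-1` _]setTI; exact: measurable_fst.
have E (k : R * R -> R) : Q.-integrable setT (EFin \o k) ->
    \int[Q]_w (k w * psi w.1) =
    fine (\int[unif]_u \int[Q]_(w in fst @^-1` [set x | (u < psi x)%R]) (k
      w)%:E)%E.
  move=> ki.
  have mk : measurable_fun setT k by apply/measurable_EFinP;
    exact: measurable_int ki.
  pose f (z : R * R * R) : R := if z.2 < psi z.1.1 then k z.1 else 0.
  have mf : measurable_fun setT f.
    apply: measurable_fun_ifT.
    - exact: (measurable_fun_ltr measurable_snd (measurableT_comp mpsi
        (@measurable_w11 R))).
    - exact: (measurableT_comp mk measurable_fst).
    - exact: measurable_cst.
  have fi : (randomized Q).-integrable setT (EFin \o f).
    apply: (le_integrableR mf _ (integrable_randomized (integrable_norm ki))).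
    by move=> z; rewrite /f /=; case: ifPn => _; rewrite ?normr0.
  transitivity (\int[randomized Q]_z f z).
    rewrite (Rintegral_randomized (p := fun w => psi w.1) (b := cst 0))//.
    by apply: eq_Rintegral => w _; rewrite /= mul0r addr0.
  rewrite /Rintegral; congr fine.
  have := integral21_prod_meas1 fi; rewrite -[X in _ = X -> _]/(integral
    (randomized Q) _ _) => <-.
  apply: eq_integral => u _ /=; rewrite [RHS]integral_mkcond.
  apply: eq_integral => w _; rewrite patchE /f.
  rewrite (_ : (w \in _) = (u < psi w.1)); last first.
    by apply/idP/idP => [/set_mem//|?]; exact/mem_set.
  by rewrite /=; case: (u < psi w.1).
rewrite !E.
- by congr fine; apply: eq_integral => u _; rewrite QE.
- exact: (@coupling_integrable1 _ _ _ _ id cQ hmu).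
- exact: (@coupling_integrable2 _ _ _ _ id cQ hnu).
Qed.

End pullout.

Section binomial_lift.
Context (R : realType) (mu1 mu2 mu3 : probability R R).
Hypotheses (hmu1 : finite_first_moment mu1) (hmu2 : finite_first_moment mu2)
  (hmu3 : finite_first_moment mu3).
Variables (Td Tu : R -> R).
Hypotheses (mTd : measurable_fun [set: R] Td) (mTu : measurable_fun [set: R] Tu).
Hypotheses (hTd : forall x, Td x <= x) (hTu : forall x, x <= Tu x).
Variables (Q : probability (R * R)%type R) (hQ : M2 mu1 mu2 Q).

Definition between : set (R * R) := [set w | Td w.1 <= w.2 <= Tu w.1].

Lemma measurable_between : measurable between.
Proof.
rewrite (_ : between = [set w | Td w.1 <= w.2] `&` [set w | w.2 <= Tu w.1]);
  last first.
  by apply/seteqP; split => w /= /andP.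
have mT1 (f : R -> R) : measurable_fun setT f -> measurable_fun setT (fun w : R
  * R => f w.1).
  by move=> mf; exact: (measurableT_comp mf measurable_fst).
apply: measurableI; rewrite -[X in measurable X]setTI.
- apply: (measurable_fun_ler _ _ measurableT (Y := [set true])) => //; exact: mT1.
- apply: (measurable_fun_ler _ _ measurableT (Y := [set true])) => //; exact: mT1.
Qed.

Hypothesis Qbetween : Q between = 1%E.

Let D x := Tu x - Td x.
Let q := up_weight Td Tu.
(* Truncated to [0, 1] so as to be a probability outside of [between] too. *)
Let p (w : R * R) : R := Num.min (Num.max ((w.2 - Td w.1) / D w.1) 0) 1.

Let D0 x : 0 <= D x.
Proof. by rewrite subr_ge0; exact: le_trans (hTd x) (hTu x). Qed.

Let p01 w : 0 <= p w <= 1.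
Proof. by rewrite /p le_min le_max lexx orbT ler01/= ge_min lexx orbT. Qed.

Let qE x : D x != 0 -> q x = (x - Td x) / D x.
Proof.
move=> Dx; rewrite /q /up_weight indicE mem_set ?mulr1//=.
by rewrite -subr_gt0 lt_neqAle eq_sym Dx/=; exact: D0.
Qed.

Let qE0 x : D x = 0 -> q x = 0.
Proof.
move=> Dx; rewrite /q /up_weight indicE memNset ?mulr0//=.
by rewrite -subr_gt0 -/(D x) Dx ltxx.
Qed.

Let q01 x : 0 <= q x <= 1.
Proof.
have [Dx|Dx] := eqVneq (D x) 0; first by rewrite qE0// lexx ler01.
have Dgt : 0 < D x by rewrite lt_neqAle eq_sym Dx D0.
rewrite (qE Dx); apply/andP; split.
  by apply: divr_ge0; [rewrite subr_ge0|exact: D0].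
by rewrite ler_pdivrMr// mul1r lerD2r.
Qed.

Let pE w : between w -> D w.1 != 0 -> p w = (w.2 - Td w.1) / D w.1.
Proof.
move=> /andP[w1 w2] Dw.
have Dgt : 0 < D w.1 by rewrite lt_neqAle eq_sym Dw D0.
have p0 : 0 <= (w.2 - Td w.1) / D w.1.
  by apply: divr_ge0; [rewrite subr_ge0|exact: D0].
rewrite /p (max_idPl p0).
by rewrite (min_idPl _)// ler_pdivrMr// mul1r lerD2r.
Qed.

Let pE0 w : D w.1 = 0 -> p w = 0.
Proof. by move=> Dw; rewrite /p Dw invr0 mulr0 maxxx min_l. Qed.

Let measurable_inv : measurable_fun [set: R] (@GRing.inv R).
Proof.
have mN0 : measurable (~` [set 0] : set R) by exact: measurableC.
rewrite -(setUv [set 0 : R]); apply/measurable_funU => //; split.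
  exact: measurable_fun_set1.
apply: open_continuous_measurable_fun.
  by rewrite openC; exact/accessible_closed_set1/hausdorff_accessible/Rhausdorff.
by move=> x /set_mem/eqP; exact: inv_continuous.
Qed.

Let mD : measurable_fun setT D.
Proof. exact: measurable_funB. Qed.

Let mDV : measurable_fun setT (fun x => (D x)^-1).
Proof. exact: (measurableT_comp measurable_inv mD). Qed.

Let m1 (f : R -> R) : measurable_fun setT f -> measurable_fun setT (fun w : R *
  R => f w.1).
Proof. by move=> mf; exact: (measurableT_comp mf measurable_fst). Qed.

Let mp : measurable_fun setT p.
Proof.
apply: measurable_minr => //; apply: measurable_maxr => //;
  apply: measurable_funM.
  by apply: measurable_funB => //; exact: m1.
exact: (m1 mDV).
Qed.

Let mq : measurable_fun setT q.
Proof.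
apply: measurable_funM.
  by apply: measurable_funM; [exact: measurable_funB|exact: mDV].
apply: measurable_indic; rewrite -[X in measurable X]setTI.
exact: (measurable_fun_ltr mTd mTu measurableT (Y := [set true])).
Qed.

Let bounded_integrable (m : probability (R * R)%type R) (f : R * R -> R) :
  measurable_fun setT f -> (forall w, `|f w| <= 1) -> m.-integrable setT (EFin
    \o f).
Proof.
move=> mf f1; apply: (le_integrableR mf f1); exact: finite_measure_integrable_cst.
Qed.

Let mind (B : set R) : measurable B -> measurable_fun setT (fun w : R * R =>
  \1_B w.1 : R).
Proof. by move=> mB; apply: (m1 (f := \1_B)); exact: measurable_indic. Qed.

Let pq1 w : `|p w - q w.1| <= 1.
Proof.
have /andP[a b] := p01 w; have /andP[c e] := q01 w.1.
by rewrite ler_norml; apply/andP; split; lra.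
Qed.

(* q(x) is the conditional expectation of p given x: where D x > 0 one has
   p w - q x = (y - x) / D x, and the unbounded factor 1 / D x is dealt with by
   discarding {0 < D < 1 / k}. *)
Let weight_eq (B : set R) : measurable B ->
  \int[Q]_w (\1_B w.1 * (p w - q w.1)) = 0.
Proof.
move=> mB; have [cQ _] := (M2P hmu1 hmu2 Q).1 hQ.
apply/eqP; rewrite -normr_le0; apply/ler_addgt0Pr => e e0; rewrite add0r.
(* Every point leaves [S n] for large n, so some [S k] has [mu1]-mass at most [e]. *)
pose S n := [set x | 0 < D x < n.+1%:R^-1].
have mS n : measurable (S n).
  rewrite (_ : S n = [set x | 0 < D x] `&` [set x | D x < n.+1%:R^-1]);
    last first.
    by apply/seteqP; split => x /= /andP.
  by apply: measurableI; rewrite -[X in measurable X]setTI;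
    apply: (measurable_fun_ltr _ _ measurableT (Y := [set true])).
have [k Sk] : exists k, (mu1 (S k) <= e%:E)%E.
  apply: nonincreasing_measure_small => //.
  - move=> a b ab; apply/subsetPset => x /= /andP[a0 xb]; apply/andP;
      split => //; apply: (lt_le_trans xb).
    by rewrite lef_pV2 ?posrE// ler_nat.
  - apply/seteqP; split => // x Sx; have /andP[Dx _] := Sx 0%N I.
    have /ltr_add_invr[k] := Dx; rewrite add0r => kD.
    by have /andP[_] := Sx k I; rewrite ltNge (ltW kD).
pose K : R := k.+1%:R.
have K0 : 0 < K by rewrite ltr0n.
pose L := B `&` [set x | K^-1 <= D x].
have mL : measurable L.
  apply: measurableI => //; rewrite -[X in measurable X]setTI.
  exact: (measurable_fun_ler _ mD measurableT (Y := [set true])).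
(* On [L] one has [K^-1 <= D x], so the factor [K^-1] brings 1 / D into [0, 1], the range that
   [M2_pullout] requires; multiplying by [K] afterwards restores 1 / D. *)
pose psi x : R := \1_L x * (K^-1 * (D x)^-1).
have mpsi : measurable_fun setT psi.
  apply: measurable_funM; first exact: measurable_indic.
  exact: measurable_funM.
have psi01 x : 0 <= psi x <= 1.
  rewrite /psi indicE; have [/set_mem[_ /= LD]|_] := boolP (x \in L); last first.
    by rewrite mul0r lexx ler01.
  have Dx : 0 < D x by apply: lt_le_trans LD; rewrite invr_gt0.
  by rewrite mul1r mulr_ge0 ?invr_ge0 ?(ltW K0)//= ler_pdivrMr// mul1r.
have pull := M2_pullout hmu1 hmu2 hQ mpsi psi01.
have i1 := @coupling_integrable1 _ _ _ _ id cQ hmu1.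
have i2 := @coupling_integrable2 _ _ _ _ id cQ hmu2.
have ipsi (g : R * R -> R) : Q.-integrable setT (EFin \o g) ->
    Q.-integrable setT (EFin \o (fun w => g w * psi w.1)).
  move=> gi; have mg : measurable_fun setT g by apply/measurable_EFinP;
    exact: measurable_int gi.
  apply: (le_integrableR _ _ (integrable_norm gi));
    first by apply: measurable_funM => //; exact: m1.
  move=> w; have /andP[a b] := psi01 w.1; by rewrite normrM (ger0_norm a)
    ler_piMr.
have mBS : measurable (B `&` S k) by exact: measurableI.
have iS : Q.-integrable setT (EFin \o (fun w => \1_(B `&` S k) w.1 * (p w - q
  w.1))).
  apply: bounded_integrable.
    by apply: measurable_funM; [exact: mind|apply: measurable_funB => //;
      exact: m1].
  move=> w; rewrite normrM; apply: (le_trans _ (pq1 w)); rewrite ler_piMl//.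
  by rewrite indicE; case: (_ \in _); rewrite ?normr1 ?normr0.
have iY := ipsi _ i2; have iX := ipsi _ i1.
have iD : Q.-integrable setT (EFin \o (fun w : R * R => K * (w.2 * psi w.1 - w.1
  * psi w.1))).
  exact: (integrableZl measurableT K (integrableB measurableT iY iX)).
(* On [between] the integrand is (y - x) / D over [L] plus its restriction to [S k]; where D = 0
   both weights vanish. The first part integrates to 0 by the pull-out identity, the second to at
   most the mass of [S k], as |p - q| <= 1. *)
rewrite (@Rintegral_eq_full _ _ _ Q between _
  (fun w => K * (w.2 * psi w.1 - w.1 * psi w.1) + \1_(B `&` S k) w.1 * (p w - q
    w.1)))//; last 4 first.
- exact: measurable_between.
- by apply: measurable_funM; [exact: mind|apply: measurable_funB => //;
    exact: m1].
- by apply: measurable_funD; apply/measurable_EFinP;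
    [exact: measurable_int iD|exact: measurable_int iS].
- move=> w bw; rewrite -mulrBl indicI /psi indicI/=.
  have [Dw|Dw] := eqVneq (D w.1) 0.
    by rewrite pE0// qE0// subr0 !mulr0 Dw invr0 !mulr0 addr0.
  have Dgt : 0 < D w.1 by rewrite lt_neqAle eq_sym Dw D0.
  rewrite pE// qE// -mulrBl.
  rewrite (_ : w.2 - Td w.1 - (w.1 - Td w.1) = w.2 - w.1); last ring.
  have -> : \1_(S k) w.1 = 1 - \1_[set x | K^-1 <= D x] w.1 :> R.
    rewrite !indicE; have [SD|SD] := boolP (w.1 \in S k).
      rewrite memNset ?subr0//=; have := set_mem SD => /= /andP[_].
      by rewrite ltNge => /negP.
    rewrite mem_set ?subrr//= leNgt; apply/negP => DK.
    have Skw : S k w.1 by apply/andP.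
    by move: SD; rewrite (mem_set Skw).
  have KV : K * K^-1 = 1 by rewrite divff// gt_eqF.
  have -> : K * ((w.2 - w.1) * (\1_B w.1 * \1_[set x | K^-1 <= D x] w.1 * (K^-1
    / D w.1))) =
    (K * K^-1) * ((w.2 - w.1) / D w.1 * (\1_B w.1 * \1_[set x | K^-1 <= D x]
      w.1)) by ring.
  rewrite KV; ring.
rewrite (RintegralD measurableT iD iS) RintegralZl//;
  last exact: (integrableB measurableT iY iX).
rewrite (RintegralB measurableT iY iX) pull subrr mulr0 add0r.
apply: le_trans (le_normr_Rintegral measurableT iS) _.
apply: (@le_trans _ _ (\int[Q]_w \1_(S k) w.1)).
  apply: le_Rintegral => //.
  - exact: integrable_norm iS.
  - apply: bounded_integrable; first exact: mind.
    by move=> w; rewrite indicE; case: (_ \in _); rewrite ?normr1 ?normr0.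
  move=> w _; rewrite normrM !indicE in_setI.
  case: (w.1 \in S k); rewrite ?andbT ?andbF /= ?normr0 ?mul0r//.
  apply: (le_trans _ (pq1 w)); rewrite ler_piMl//.
  by case: (w.1 \in B); rewrite /= ?normr1 ?normr0.
have mS1 : measurable (fst @^-1` S k : set (R * R)).
  by rewrite -[_ @^-1` _]setTI; exact: measurable_fst.
have -> : (fun w : R * R => \1_(S k) w.1 : R) = \1_(fst @^-1` S k).
  by apply/funext => w; rewrite !indicE; congr (_%:R);
    apply/idP/idP => /set_mem ?; exact/mem_set.
rewrite Rintegral_indic// -lee_fin fineK ?fin_num_measure//.
by apply: le_trans Sk; rewrite -(cQ.1 (S k) (mS k)); exact: lexx.
Qed.

Let star := binomial_coupling mu1 mTd mTu hTd hTu.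
Hypothesis star_M2 : M2 mu1 mu3 star.

Let W (z : R * R * R) : R * R * R :=
  (z.1, if z.2 < p z.1 then Tu z.1.1 else Td z.1.1).

Let mW : measurable_fun setT W.
Proof.
apply: measurable_fun_pair; first exact: measurable_fst.
apply: measurable_fun_ifT.
- exact: (measurable_fun_ltr measurable_snd (measurableT_comp mp measurable_fst)).
- exact: (measurableT_comp mTu (@measurable_w11 R)).
- exact: (measurableT_comp mTd (@measurable_w11 R)).
Qed.

Definition binomial_lift : probability (R * R * R)%type R := law (randomized Q)
  mW.

Let binomial_lift_proj12 A : measurable A -> binomial_lift (@proj12 R @^-1` A) =
  Q A.
Proof.
move=> mA; transitivity (randomized Q (A `*` setT)).
  by rewrite lawE; congr (randomized _ _); apply/seteqP; split => -[w u] //= [].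
by rewrite randomizedX// probability_setT mule1.
Qed.

(** Integrating out u gives a p + b (1 - p), where [a] and [b] are indicators depending on S1 only.
    Replacing [p] by [q] changes this by (a - b)(p - q), whose integral is 0 by two uses of
    [weight_eq]; what remains is the mass under [star]. *)
Lemma binomial_lift_proj13 S : measurable S -> binomial_lift (@proj13 R @^-1` S)
  = star S.
Proof.
move=> mS; have [cQ _] := (M2P hmu1 hmu2 Q).1 hQ.
pose T13 (f : R -> R) := [set x | S (x, f x)].
have mT13 (f : R -> R) : measurable_fun setT f -> measurable (T13 f).
  move=> mf; rewrite -[T13 f]setTI; apply: measurable_fun_pair => //.
pose a (w : R * R) : R := \1_(T13 Tu) w.1.
pose b (w : R * R) : R := \1_(T13 Td) w.1.
have ma : measurable_fun setT a by apply: mind; exact: mT13.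
have mb : measurable_fun setT b by apply: mind; exact: mT13.
have a1 w : `|a w| <= 1 by rewrite /a indicE; case: (_ \in _);
  rewrite ?normr1 ?normr0.
have b1 w : `|b w| <= 1 by rewrite /b indicE; case: (_ \in _);
  rewrite ?normr1 ?normr0.
pose F (z : R * R * R) : R := if z.2 < p z.1 then a z.1 else b z.1.
have mF : measurable_fun setT F.
  apply: measurable_fun_ifT.
  - exact: (measurable_fun_ltr measurable_snd (measurableT_comp mp
      measurable_fst)).
  - exact: (measurableT_comp ma measurable_fst).
  - exact: (measurableT_comp mb measurable_fst).
have mWS : measurable (W @^-1` (@proj13 R @^-1` S)).
  rewrite -[_ @^-1` _]setTI; apply: mW => //.
  by rewrite -[_ @^-1` _]setTI; exact: measurable_proj13.
have FE : F = \1_(W @^-1` (@proj13 R @^-1` S)).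
  apply/funext => z; rewrite /F /a /b !indicE /W.
  have -> : (z \in W @^-1` (@proj13 R @^-1` S)) =
     (if z.2 < p z.1 then z.1.1 \in T13 Tu else z.1.1 \in T13 Td).
    transitivity `[< S (z.1.1, if z.2 < p z.1 then Tu z.1.1 else Td z.1.1) >].
      by apply/idP/asboolP => [/set_mem//|?]; exact/mem_set.
    by case: ifPn => _; apply/asboolP/idP => [?|/set_mem//]; exact/mem_set.
  by case: ifPn.
have Fi : (randomized Q).-integrable setT (EFin \o F).
  by rewrite FE; exact: integrable_indic.
have L : fine (binomial_lift (@proj13 R @^-1` S)) = \int[Q]_w (a w * p w + b w *
  (1 - p w)).
  rewrite -(Rintegral_randomized p01 Fi) -/F FE Rintegral_indic//.
have bi (f g : R * R -> R) : measurable_fun setT f -> measurable_fun setT g ->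
    (forall w, `|f w| <= 1) -> (forall w, `|g w| <= 1) ->
    Q.-integrable setT (EFin \o (fun w => f w * g w)).
  move=> mf mg f1 g1; apply: bounded_integrable; first exact: measurable_funM.
  by move=> w; rewrite normrM mulr_ile1.
have mq1 := m1 mq.
have mpq : measurable_fun setT (fun w => p w - q w.1) by exact: measurable_funB.
have q1 (w : R * R) : `|q w.1| <= 1.
  by have /andP[x y] := q01 w.1; rewrite ger0_norm.
have q1' (w : R * R) : `|1 - q w.1| <= 1.
  by have /andP[x y] := q01 w.1; rewrite ler_norml; apply/andP; split; lra.
have m1q : measurable_fun setT (fun w : R * R => 1 - q w.1) by exact:
  measurable_funB.
have i1 := bi _ _ ma mq1 a1 q1.
have i2 := bi _ _ mb m1q b1 q1'.
have i3 := bi _ _ ma mpq a1 pq1.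
have i4 := bi _ _ mb mpq b1 pq1.
have L2 : \int[Q]_w (a w * p w + b w * (1 - p w)) =
    \int[Q]_w (a w * q w.1 + b w * (1 - q w.1)).
  transitivity (\int[Q]_w ((a w * q w.1 + b w * (1 - q w.1)) +
      (a w * (p w - q w.1) - b w * (p w - q w.1)))).
    by apply: eq_Rintegral => w _; ring.
  rewrite (RintegralD measurableT (integrableD measurableT i1 i2) (integrableB
    measurableT i3 i4)).
  rewrite (RintegralB measurableT i3 i4) !weight_eq ?subrr ?addr0//.
  - exact: mT13.
  - exact: mT13.
have mi : mu1.-integrable setT (EFin \o (fun x => \1_(T13 Tu) x * q x + \1_(T13
  Td) x * (1 - q x))).
  have ind (B : set R) (f : R -> R) : measurable B -> measurable_fun setT f ->
      (forall x, `|f x| <= 1) -> mu1.-integrable setT (EFin \o (fun x => \1_B x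
        * f x)).
    move=> mB mf f1; apply: integrable_indicM => //;
      apply: (le_integrableR mf f1).
    exact: finite_measure_integrable_cst.
  apply: (integrableD measurableT (ind _ q _ _ _) (ind _ (fun x => 1 - q x) _ _
    _)).
  - exact: mT13.
  - exact: mq.
  - by move=> x; exact: (q1 (x, x)).
  - exact: mT13.
  - exact: measurable_funB.
  - by move=> x; exact: (q1' (x, x)).
have S1 : star S = (\int[mu1]_x (\1_(T13 Tu) x * q x + \1_(T13 Td) x * (1 - q
  x))%:E)%E.
  rewrite /star /binomial_coupling/= /binomial_coupling_fun;
    apply: eq_integral => x _.
  rewrite /binomial_kernel !diracE !mem_xsection -!EFinM -EFinD !indicE -/q.
  have inT (f : R -> R) : (x \in T13 f) = ((x, f x) \in S).
    by apply/idP/idP => /set_mem ?; exact/mem_set.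
  by rewrite !inT; congr (_%:E); ring.
rewrite -[LHS]fineK ?fin_num_measure//; last first.
  by rewrite -[_ @^-1` _]setTI; exact: measurable_proj13.
rewrite L L2 S1 -(has_law_integral measurable_fst cQ.1 mi) /Rintegral fineK//.
apply: (integrable_fin_num measurableT); exact: (integrableD measurableT i1 i2).
Qed.

Let law1 : has_law binomial_lift (fun w => w.1.1) mu1.
Proof.
have [cQ _] := (M2P hmu1 hmu2 Q).1 hQ.
move=> A mA; rewrite -(cQ.1 A mA); apply: (binomial_lift_proj12 (A := fst @^-1`
  A)).
by rewrite -[_ @^-1` _]setTI; exact: measurable_fst.
Qed.

Let law2 : has_law binomial_lift (fun w => w.1.2) mu2.
Proof.
have [cQ _] := (M2P hmu1 hmu2 Q).1 hQ.
move=> A mA; rewrite -(cQ.2 A mA); apply: (binomial_lift_proj12 (A := snd @^-1`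
  A)).
by rewrite -[_ @^-1` _]setTI; exact: measurable_snd.
Qed.

Let law3 : has_law binomial_lift snd mu3.
Proof.
move=> A mA; have [_ h _] := star_M2; rewrite -(h A mA).
apply: (binomial_lift_proj13 (S := snd @^-1` A)).
by rewrite -[_ @^-1` _]setTI; exact: measurable_snd.
Qed.

(** On [between] the conditional mean Tu p + Td (1 - p) of S3 given (S1, S2) equals S2; where D = 0,
    [between] itself forces S2 = Td. The third marginal is [mu3] because (S1, S3) has the law
    [star]. *)
Lemma binomial_lift_M3 : M3 mu1 mu2 mu3 binomial_lift.
Proof.
have [cQ QE] := (M2P hmu1 hmu2 Q).1 hQ.
have j1 := has_law_integrable (@measurable_w11 R) law1 hmu1.
have j2 := has_law_integrable (@measurable_w12 R) law2 hmu2.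
have j3 := has_law_integrable measurable_snd law3 hmu3.
have red (A : set (R * R)) (f : R * R -> R) : measurable A -> measurable_fun
  setT f ->
    binomial_lift.-integrable setT (EFin \o (f \o @proj12 R)) ->
    (\int[binomial_lift]_(w in @proj12 R @^-1` A) (f w.1)%:E = \int[Q]_(w in A)
      (f w)%:E)%E.
  move=> mA mf fi.
  have := integral_law (@measurable_proj12 R) mA (measurableT_comp
    (@EFin_measurable R setT) mf) fi.
  move=> <-; apply: eq_measure_integral => B mB _; exact: binomial_lift_proj12.
apply: mk_M3 => // A mA.
  have mA1 : measurable (fst @^-1` A : set (R * R)).
    by rewrite -[_ @^-1` _]setTI; exact: measurable_fst.
  have r1 := red _ fst mA1 measurable_fst j1.
  have r2 := red _ snd mA1 measurable_snd j2.
  apply: (eq_trans r1); apply: (eq_trans _ (esym r2)); exact: QE.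
have mA1 : measurable (@proj12 R @^-1` A).
  by rewrite -[_ @^-1` _]setTI; exact: measurable_proj12.
have r2 := red _ snd mA measurable_snd j2.
apply: (eq_trans r2).
apply: integral_Rintegral_eq => //.
  exact: (@coupling_integrable2 _ _ _ _ id cQ hmu2).
rewrite [LHS]Rintegral_indicM [RHS]Rintegral_indicM.
have mZ : measurable_fun setT (fun w : R * R * R => \1_(@proj12 R @^-1` A) w *
  w.2).
  by apply: measurable_funM; [exact: measurable_indic|exact: measurable_snd].
have k3 := integrable_indicM mA1 j3.
pose a (w : R * R) : R := \1_A w * Tu w.1.
pose b (w : R * R) : R := \1_A w * Td w.1.
have WE z : \1_(@proj12 R @^-1` A) (W z) * (W z).2 = if z.2 < p z.1 then a z.1
  else b z.1.
  rewrite /a /b !indicE (_ : (_ \in _ @^-1` _) = (z.1 \in A)).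
    by rewrite /W/=; case: ifPn.
  by apply/idP/idP => /set_mem ?; exact/mem_set.
have k3' : (randomized Q).-integrable setT
    (fun z => (if z.2 < p z.1 then a z.1 else b z.1)%:E).
  have := (integrable_law (randomized Q) mW (measurableT_comp (@EFin_measurable
    R setT) mZ)).1 k3.
  by apply: eq_integrable => // z _; rewrite /= -WE.
rewrite (Rintegral_law mW mZ); last first.
  by apply: eq_integrable k3' => // z _; rewrite /= -WE.
under [RHS]eq_Rintegral do rewrite WE.
rewrite (Rintegral_randomized p01 k3').
apply: (@Rintegral_eq_full _ _ _ Q between) => //.
- exact: measurable_between.
- apply: measurable_funM; [exact: measurable_indic|exact: measurable_snd].
- apply: measurable_funD; apply: measurable_funM => //.
  + by apply: measurable_funM; [exact: measurable_indic|exact: m1].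
  + by apply: measurable_funM; [exact: measurable_indic|exact: m1].
  + exact: measurable_funB.
move=> w bw; rewrite /a /b.
have [Dw|Dw] := eqVneq (D w.1) 0.
  rewrite (pE0 Dw) mulr0 add0r subr0 mulr1; congr (_ * _).
  move: bw Dw => /andP[x y]; rewrite /D; lra.
rewrite (pE bw Dw) -!mulrA -mulrDr; congr (_ * _).
rewrite (_ : Tu w.1 = Td w.1 + D w.1); last by rewrite /D; ring.
by field.
Qed.

End binomial_lift.

(** * Support of the limit law *)

Section support.
Context (R : realType) (mu1 mu2 mu3 : probability R R).
Hypotheses (hmu1 : finite_first_moment mu1) (hmu2 : finite_first_moment mu2)
  (hmu3 : finite_first_moment mu3).
Variables (Td Tu : R -> R).
Hypotheses (mTd : measurable_fun [set: R] Td) (mTu : measurable_fun [set: R] Tu).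
Hypotheses (hTd : forall x, Td x <= x) (hTu : forall x, x <= Tu x).
Variables (P12 P13 : probability (R * R)%type R).
Hypothesis cP12 : coupling mu1 mu2 P12.
Hypothesis P13E : forall S, measurable S ->
  P13 S = binomial_coupling mu1 mTd mTu hTd hTu S.
Hypothesis hinge_le : forall (A : set R) (e k : R), measurable A ->
  \int[P12]_w (\1_A w.1 * Num.max (e * (w.2 - k)) 0) <=
  \int[P13]_w (\1_A w.1 * Num.max (e * (w.2 - k)) 0).

Let N (A : set R) (e k : R) : set (R * R) := [set w | A w.1 /\ 0 < e * (w.2 - k)].

Let mN A e k : measurable A -> measurable (N A e k).
Proof.
move=> mA; rewrite (_ : N A e k = fst @^-1` A `&` [set w | 0 < e * (w.2 - k)])//.
apply: measurableI; first by rewrite -[_ @^-1` _]setTI; exact: measurable_fst.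
rewrite -[X in measurable X]setTI.
apply: (measurable_fun_ltr _ _ measurableT (Y := [set true])) => //.
by apply: measurable_funM => //; exact: measurable_funB.
Qed.

Let mhinge A e k : measurable A ->
  measurable_fun setT (fun w : R * R => \1_A w.1 * Num.max (e * (w.2 - k)) 0).
Proof.
move=> mA; apply: measurable_funM.
  by apply: measurableT_comp => //; exact: measurable_indic.
by apply: measurable_funrpos; apply: measurable_funM => //;
  exact: measurable_funB.
Qed.

(** For x in [A] both atoms of the kernel have zero hinge, so the right-hand side of [hinge_le] is
    0. The nonnegative integrand on the left then vanishes [P12]-almost surely, although it is
    positive on [N A e k]. *)
Let N_null A e k : measurable A ->
  (forall x, A x -> e * (Td x - k) <= 0 /\ e * (Tu x - k) <= 0) ->
  P12 (N A e k) = 0%E.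
Proof.
move=> mA HA; have mNA := mN e k mA; have mf := mhinge e k mA.
have N13 : P13 (N A e k) = 0%E.
  rewrite P13E// /binomial_coupling/= /binomial_coupling_fun integral0_eq// => x
    _.
  rewrite /binomial_kernel !diracE !mem_xsection.
  rewrite !memNset ?mule0 ?adde0//.
    by move=> [/= /HA[+ _]]; rewrite leNgt => /negP.
  by move=> [/= /HA[_]]; rewrite leNgt => /negP.
have f13 : \int[P13]_w (\1_A w.1 * Num.max (e * (w.2 - k)) 0) = 0.
  transitivity (\int[P13]_w (cst (0 : R) w));
    last by rewrite Rintegral_cst// mul0r.
  apply: (@Rintegral_eq_full _ _ _ P13 (~` N A e k)) => //.
  - exact: measurableC.
  - by rewrite probability_setC// N13 sube0.
  - move=> w NAw; rewrite indicE; have [/set_mem Aw|_] := boolP (w.1 \in A);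
      last by rewrite mul0r.
    rewrite mul1r max_r// leNgt; apply/negP => ek; exact: NAw.
have fi : P12.-integrable setT
    (EFin \o (fun w => \1_A w.1 * Num.max (e * (w.2 - k)) 0)).
  have mA1 : measurable (fst @^-1` A : set (R * R)).
    by rewrite -[_ @^-1` _]setTI; exact: measurable_fst.
  exact: (integrable_indicM mA1 (C_lin2_integrable hmu1 hmu2 (C_lin2_hinge e k)
    cP12)).
have f0 w : 0 <= \1_A w.1 * Num.max (e * (w.2 - k)) 0 :> R.
  by rewrite mulr_ge0// le_max lexx orbT.
have f12 : (\int[P12]_w `|(\1_A w.1 * Num.max (e * (w.2 - k)) 0)%:E| = 0)%E.
  under eq_integral do rewrite gee0_abs ?lee_fin ?f0//.
  rewrite -[LHS]fineK; last exact: (integrable_fin_num measurableT fi).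
  congr (_%:E); apply/eqP; rewrite eq_le; apply/andP; split.
    by have := hinge_le e k mA; rewrite f13.
  by apply: Rintegral_ge0 => w _; exact: f0.
have /(ae_eq_integral_abs P12 measurableT)[|M [mM M0 sM]] := f12;
  first exact/measurable_EFinP.
apply: measure_negligible => //; exists M; split => // w [Aw ek];
  apply: sM => /(_ I).
rewrite indicE mem_set// mul1r max_l ?(ltW ek)//= => -[ek0].
by rewrite ek0 ltxx in ek.
Qed.

(** If S2 violates one of the bounds, some rational lies strictly between S2 and that bound. The
    violation is thus covered by countably many null sets, with e = 1 for the upper bound and e = -1
    for the lower one. *)
Lemma hinge_le_between : P12 (between Td Tu) = 1%E.
Proof.
have mb := measurable_between mTd mTu.
have mU k : measurable [set x | Tu x <= k].
  rewrite -[X in measurable X]setTI.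
  exact: (measurable_fun_ler mTu _ measurableT (Y := [set true])).
have mD k : measurable [set x | k <= Td x].
  rewrite -[X in measurable X]setTI.
  exact: (measurable_fun_ler _ mTd measurableT (Y := [set true])).
have nU k : P12 (N [set x | Tu x <= k] 1 k) = 0%E.
  apply: N_null => // x /= xk; rewrite !mul1r !subr_le0; split => //.
  exact: le_trans (le_trans (hTd x) (hTu x)) xk.
have nD k : P12 (N [set x | k <= Td x] (-1) k) = 0%E.
  apply: N_null => // x /= xk; rewrite !mulN1r !oppr_le0 !subr_ge0; split => //.
  exact: le_trans xk (le_trans (hTd x) (hTu x)).
pose r : nat -> R := @rat_seq R.
have null : P12.-negligible (\bigcup_n (N [set x | Tu x <= r n] 1 (r n) `|`
    N [set x | r n <= Td x] (-1) (r n))).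
  apply: negligible_bigcup => n; apply: negligibleU.
    by exists (N [set x | Tu x <= r n] 1 (r n)); split;
      [exact: (mN _ _ (mU _))|exact: nU|by []].
  by exists (N [set x | r n <= Td x] (-1) (r n)); split;
    [exact: (mN _ _ (mD _))|exact: nD|by []].
have C0 : P12 (~` between Td Tu) = 0%E.
  apply: measure_negligible; first exact: measurableC.
  apply: negligibleS null => w /= /negP; rewrite negb_and -!ltNge => /orP[yT|Ty].
    have [n /andP[n1 n2]] := rat_seq_dense yT; exists n => //; right.
    by split => /=; [exact: ltW|rewrite mulN1r oppr_gt0 subr_lt0].
  have [n /andP[n1 n2]] := rat_seq_dense Ty; exists n => //; left.
  by split => /=; [exact: ltW|rewrite mul1r subr_gt0].
have := @probability_setC _ _ _ P12 _ mb; rewrite [X in X = _]C0 => /esym/eqP.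
rewrite sube_eq ?add0e// ?fin_num_measure// => /eqP H; exact/esym.
Qed.

End support.

(** * Expected costs and the equivalence *)

Section expectations.
Context (R : realType) (mu1 mu2 mu3 : probability R R) (c : R * R -> R).
Hypotheses (hmu1 : finite_first_moment mu1) (hmu2 : finite_first_moment mu2)
  (hmu3 : finite_first_moment mu3) (hc : C_lin2 c).
Local Open Scope ereal_scope.

Lemma expectation_coupling (Q : probability (R * R)%type R) : coupling mu1 mu3 Q
  ->
  'E_Q[c] = (\int[Q]_w c w)%R%:E.
Proof.
move=> cQ; rewrite unlock /Rintegral fineK//.
exact: (integrable_fin_num measurableT (C_lin2_integrable hmu1 hmu3 hc cQ)).
Qed.

Lemma M3_expectation (Q : probability (R * R * R)%type R) : M3 mu1 mu2 mu3 Q ->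
  'E_Q[fun w => c (w.1.1, w.2)] = 'E_(law Q (@measurable_proj13 R))[c].
Proof.
move=> hQ; rewrite unlock.
have [c13 _] := (M2P hmu1 hmu3 _).1 (law_proj13_M2 hmu1 hmu3 hQ).
have mc := measurableT_comp (@EFin_measurable R setT) (continuous2_measurable
  hc.1).
have ci := (integrable_law Q (@measurable_proj13 R) mc).1
  (C_lin2_integrable hmu1 hmu3 hc c13).
by have := integral_law (@measurable_proj13 R) measurableT mc ci;
  rewrite preimage_setT => ->.
Qed.

(** Forgetting S2 maps three-period laws to two-period laws at the same cost; equality of the infima
    is therefore a matter of the reverse inequality. *)
Lemma inf_M2_le_inf_M3 : inf_M2 c mu1 mu3 <= inf_M3 c mu1 mu2 mu3.
Proof.
apply: le_ereal_inf_tmp => _ [Q hQ <-]; rewrite (M3_expectation hQ).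
by apply: ereal_inf_lbound; exists (law Q (@measurable_proj13 R)) => //;
  exact: (law_proj13_M2 hmu1 hmu3 hQ).
Qed.

End expectations.

Theorem proposition3p7 (R : realType) (c : R * R -> R)
    (mu1 mu2 mu3 : probability R R) (Td Tu : R -> R)
    (hc : C_lin2 c)
    (hmu1 : finite_first_moment mu1)
    (hmu2 : finite_first_moment mu2)
    (hmu3 : finite_first_moment mu3)
    (h12 : convex_order mu1 mu2)
    (h23 : convex_order mu2 mu3)
    (mTd : measurable_fun [set: R] Td)
    (mTu : measurable_fun [set: R] Tu)
    (hTd : forall x, Td x <= x)
    (hTu : forall x, x <= Tu x)
    (hopt : optimizers c mu1 mu3 =
      [set Q : probability (R * R)%type R |
        measure_eq Q (binomial_coupling mu1 mTd mTu hTd hTu)]) :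
  inf_M3 c mu1 mu2 mu3 = inf_M2 c mu1 mu3 <->
  exists Q : probability (R * R)%type R,
    M2 mu1 mu2 Q /\ Q [set w : R * R | Td w.1 <= w.2 <= Tu w.1] = 1%:E.
Proof.
set star := binomial_coupling mu1 mTd mTu hTd hTu.
have [star_M2 star_E] : optimizers c mu1 mu3 star by rewrite hopt.
have [star_c _] := (M2P hmu1 hmu3 star).1 star_M2.
split=> [inf_eq|[Q [hQ Qb]]]; last first.
  apply/eqP; rewrite eq_le inf_M2_le_inf_M3// andbT -star_E.
  have hL := binomial_lift_M3 hmu1 hmu2 hmu3 hQ Qb star_M2.
  (* The lift is admissible for three periods and has the cost of [star], the optimal two-period
     value. *)
  apply: ereal_inf_lbound; exists (binomial_lift mTd mTu Q) => //.
  rewrite (M3_expectation hmu1 hmu3 hc hL) unlock.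
  apply: eq_measure_integral => A mA _; exact: (binomial_lift_proj13 hmu1 hmu2).
(* Attainment by [star], under which [c] is integrable, makes the infimum finite, so a minimizing
   sequence with error 1 / (n + 1) exists. *)
have inf_fin : inf_M2 c mu1 mu3 \is a fin_num.
  by rewrite -star_E (expectation_coupling hmu1 hmu3 hc star_c).
pose I := fine (inf_M2 c mu1 mu3).
have IE : inf_M2 c mu1 mu3 = I%:E by rewrite /I fineK.
pose p12 (Q : probability (R * R * R)%type R) := law Q (@measurable_proj12 R).
pose p13 (Q : probability (R * R * R)%type R) := law Q (@measurable_proj13 R).
have min_seq (n : nat) : exists Q : probability (R * R * R)%type R,
    M3 mu1 mu2 mu3 Q /\ \int[p13 Q]_w c w <= I + n.+1%:R^-1.
  have n0 : 0 < n.+1%:R^-1 :> R by rewrite invr_gt0.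
  have := lb_ereal_inf_adherent n0.
  move=> /(_ [set 'E_Q[fun w => c (w.1.1, w.2)] | Q in M3 mu1 mu2 mu3]%E).
  rewrite -/(inf_M3 c mu1 mu2 mu3) inf_eq => /(_ inf_fin)[_ [Q hQ <-]].
  have [c13 _] := (M2P hmu1 hmu3 _).1 (law_proj13_M2 hmu1 hmu3 hQ).
  rewrite (M3_expectation hmu1 hmu3 hc hQ) (expectation_coupling hmu1 hmu3 hc
    c13).
  by rewrite IE -EFinD lte_fin => /ltW H; exists Q.
have [Q HQ] := choice min_seq.
have QM n : M3 mu1 mu2 mu3 (Q n) by have [] := HQ n.
(* [U] refines [\oo], so ordinary limits persist along it; the same [U] serves both pairs, which
   lets inequalities between them pass to the limit. *)
have [U [UU sU]] := @ultraFilterLemma nat \oo _.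
have [P12 hP12 lim12] := M2_ultralimit hmu1 hmu2 (fun n => law_proj12_M2 hmu1
  hmu2 (QM n)).
have [P13 hP13 lim13] := M2_ultralimit hmu1 hmu3 (fun n => law_proj13_M2 hmu1
  hmu3 (QM n)).
have [c12 _] := (M2P hmu1 hmu2 _).1 hP12.
have [c13 _] := (M2P hmu1 hmu3 _).1 hP13.
have indT (m : probability (R * R)%type R) :
    \int[m]_w (\1_(@setT R) w.1 * c w) = \int[m]_w c w.
  by apply: eq_Rintegral => w _; rewrite indicT mul1r.
have P13_le : \int[P13]_w c w <= I.
  have cI : I + n.+1%:R^-1 @[n --> U] --> I.
    have : I + n.+1%:R^-1 @[n --> \oo] --> I.
      by rewrite -[X in _ --> X]addr0; apply: cvgD;
        [exact: cvg_cst|exact: cvg_harmonic].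
    by move=> H A /H; exact: sU.
  have := lim13 _ _ measurableT hc; rewrite indT => l13.
  apply: (ler_cvg_to l13 cI); apply: nearW => n; rewrite indT; exact: (HQ n).2.
(* The limit is admissible and costs at most the infimum, hence is optimal; uniqueness of the
   optimizer then identifies it with [star] on measurable sets. *)
have P13_opt : optimizers c mu1 mu3 P13.
  split => //; apply/eqP; rewrite eq_le; apply/andP; split.
    by rewrite (expectation_coupling hmu1 hmu3 hc c13) IE lee_fin.
  by apply: ereal_inf_lbound; exists P13.
rewrite hopt in P13_opt.
have P13E S : measurable S -> P13 S = star S by exact: P13_opt.
exists P12; split => //.
apply: (hinge_le_between (mTd := mTd) (mTu := mTu) hmu1 hmu2 c12 P13E) => A e k
  mA.
have l12 := lim12 _ _ mA (C_lin2_hinge e k); have l13 := lim13 _ _ mA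
  (C_lin2_hinge e k).
by apply: (ler_cvg_to l12 l13); apply: nearW => n; exact: (M3_hinge_le hmu2 hmu3).
Qed.
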